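(* Suppose that $\ell_1$ and $\ell_2$ are ascending lines in $\mathbb{R}^d$ with different direction vectors. Then their Cremona-convex hull is the interval they define on $G(\ell_1,\ell_2)$ consisting of ascending lines. If $d=2$, or if the two lines are disjoint and have direction vectors whose affine span does not meet any codimension $2$ coordinate plane, then this is also their frame-convex hull.
   Context: A line in $\mathbb{R}^d$ is ascending if all coordinates of its direction vector are non-zero and have the same sign. A box is a product of $d$ (closed, bounded, possibly degenerate) intervals, one in each coordinate direction. A frame-convex set of ascending lines is the set of ascending lines that meet every box in a given collection of boxes; the frame-convex hull of $\ell_1,\ell_2$ is the set of ascending lines meeting every box that meets both $\ell_1$ and $\ell_2$. An ascending line through $x$ with direction vector $v$ (positive coordinates) has Cremona coordinates $(y,w)$, $y_i=x_i/v_i$, $w_i=1/v_i$, with $y$ taken modulo translation by $(1,\dots,1)$ and $w$ modulo positive scaling, normalized by $\sum_iy_i=0$, $\sum_iw_i=1$. A set of ascending lines is Cremona-convex if its set of Cremona coordinates is convex; the Cremona-convex hull of a set of lines is the set of lines whose Cremona coordinates lie in the convex hull of the Cremona coordinates of the given lines. Plücker space $\mathbb{P}$ has homogeneous coordinates $p_{0i}=v_i$ ($1\le i\le d$), $p_{ij}=x_iv_j-x_jv_i$ ($1\le i<j\le d$), and contains the Grassmannian $G(1,d)$ of lines in $\mathbb{P}^d$. The Cremona transformation $C:\mathbb{P}\dashrightarrow\mathbb{P}$, $q=C(p)$, $q_{0i}=1/p_{0i}$, $q_{ij}=p_{ij}/(p_{0i}p_{0j})$, is a birational involution mapping $G(1,d)$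 birationally onto the linear subspace $LG(d)$: $q_{jk}-q_{ik}+q_{ij}=0$ ($1\le i<j<k\le d$); in terms of $(y,w)$, $q_{0i}=w_i$ and $q_{ij}=y_i-y_j$. The Cremona-affine span (hull) $G(\ell_1,\ell_2)$ is the closure of the image under $C$ of the line in $LG(d)$ spanned by $C(\ell_1)$ and $C(\ell_2)$. It is a rational curve of lines, topologically a circle, which $\ell_1$ and $\ell_2$ divide into two intervals, one of which consists of ascending lines. The affine span of two direction vectors is understood as the line spanned by the corresponding points in the hyperplane at infinity $z_0=0$ of $\mathbb{P}^d$ (homogeneous coordinates $z_0,\dots,z_d$); the codimension $2$ coordinate planes there are $z_i=z_j=0$, $1\le i<j\le d$. *)

(* Defs.v *)
(* MathComp-Analysis *)
From HB Require Import structures.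
From mathcomp Require Import all_boot all_order all_algebra.
From mathcomp Require Import all_classical all_reals all_analysis.

Set Implicit Arguments.
Unset Strict Implicit.
Unset Printing Implicit Defensive.

Import Order.TTheory GRing.Theory Num.Theory.
Import numFieldNormedType.Exports.

Local Open Scope classical_set_scope.
Local Open Scope ring_scope.
Local Open Scope quotient_scope.

(** * Lines and boxes in R^d; a line is the set of its points *)

Definition line_through (R : realType) (d : nat) (x v : 'rV[R]_d) :
    set 'rV[R]_d :=
  [set z | exists t : R, z = x + t *: v].

Definition is_direction (R : realType) (d : nat) (l : set 'rV[R]_d)
    (v : 'rV[R]_d) : Prop :=
  v != 0 /\ exists x, l = line_through x v.

Definition ascending (R : realType) (d : nat) (l : set 'rV[R]_d) : Prop :=
  exists2 v, is_direction l v &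
    (forall i, 0 < v 0 i) \/ (forall i, v 0 i < 0).

(* A line has a whole punctured line of direction vectors, so having different
   directions means having no direction vector in common. *)
Definition different_directions (R : realType) (d : nat)
    (l1 l2 : set 'rV[R]_d) : Prop :=
  ~ exists v, is_direction l1 v /\ is_direction l2 v.

Definition box (R : realType) (d : nat) (a b : 'rV[R]_d) : set 'rV[R]_d :=
  [set z | forall i, a 0 i <= z 0 i <= b 0 i].

Definition frame_hull (R : realType) (d : nat) (l1 l2 : set 'rV[R]_d) :
    set (set 'rV[R]_d) :=
  [set l | ascending l /\
    forall a b : 'rV[R]_d, (forall i, a 0 i <= b 0 i) ->
      box a b `&` l1 !=set0 -> box a b `&` l2 !=set0 ->
      box a b `&` l !=set0].

(** * Cremona coordinates and Cremona convexity *)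

Definition convex_hull (R : realType) (V : lmodType R) (A : set V) : set V :=
  smallest (@convex_set R V) A.

(* Moving x along the line translates y by multiples of (1, ..., 1), while
   scaling v scales w and y jointly; the two normalizing equations select one
   pair (y, w) for each ascending line. *)
Definition cremona_coords (R : realType) (d : nat) (l : set 'rV[R]_d) :
    set ('rV[R]_d * 'rV[R]_d) :=
  [set yw | exists x v : 'rV[R]_d,
    [/\ l = line_through x v, forall i, 0 < v 0 i,
        yw = (\row_i (x 0 i / v 0 i), \row_i (v 0 i)^-1),
        \sum_i yw.1 0 i = 0 & \sum_i yw.2 0 i = 1]].

Definition cremona_hull (R : realType) (d : nat) (S : set (set 'rV[R]_d)) :
    set (set 'rV[R]_d) :=
  [set l | exists2 c, cremona_coords l c &
    convex_hull (\bigcup_(m in S) cremona_coords m) c].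

(** * Real Plücker space, with its quotient topology *)

(* The pair p stands for the coordinates p_{0i} = p.1 0 i and p_{ij} = p.2 i j;
   the latter are stored for all i and j by means of the convention
   p_{ji} = - p_{ij}. *)
Definition nonzero_pcoords (R : realType) (d : nat) :
    set ('rV[R]_d * 'M[R]_d) :=
  [set p | p.2^T = - p.2 /\ p <> 0].

Definition proportional (R : realType) (d : nat) :
    rel (set_type (@nonzero_pcoords R d)) :=
  fun p q => `[< exists2 c : R, c != 0 & set_val p = c *: set_val q >].

Lemma proportional_refl (R : realType) (d : nat) :
  reflexive (@proportional R d).
Proof. by move=> p; apply/asboolP; exists 1; rewrite ?oner_eq0 ?scale1r. Qed.

Lemma proportional_sym (R : realType) (d : nat) :
  symmetric (@proportional R d).
Proof.
move=> p q; apply/asboolP/asboolP => -[c c0 e]; exists c^-1;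
  by rewrite ?invr_eq0 // e scalerA mulVf // scale1r.
Qed.

Lemma proportional_trans (R : realType) (d : nat) :
  transitive (@proportional R d).
Proof.
move=> q p r /asboolP[c c0 e] /asboolP[c' c'0 e']; apply/asboolP.
by exists (c * c'); rewrite ?mulf_neq0 // e e' scalerA.
Qed.

Canonical proportional_equiv (R : realType) (d : nat) :=
  EquivRel (@proportional R d) (@proportional_refl R d)
    (@proportional_sym R d) (@proportional_trans R d).

Definition plucker_space (R : realType) (d : nat) : Type :=
  quotient_topology {eq_quot (@proportional R d)}.

Definition has_coords (R : realType) (d : nat) (P : plucker_space R d)
    (p : 'rV[R]_d * 'M[R]_d) : Prop :=
  exists2 u : set_type (@nonzero_pcoords R d),
    set_val u = p & P = \pi_(plucker_space R d) u.

Definition plucker_coords (R : realType) (d : nat) (x v : 'rV[R]_d) :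
    'rV[R]_d * 'M[R]_d :=
  (v, \matrix_(i, j) (x 0 i * v 0 j - x 0 j * v 0 i)).

Definition plucker_point (R : realType) (d : nat) (l : set 'rV[R]_d)
    (P : plucker_space R d) : Prop :=
  exists x v, [/\ v != 0, l = line_through x v &
                  has_coords P (plucker_coords x v)].

Definition plucker_image (R : realType) (d : nat) (S : set (set 'rV[R]_d)) :
    set (plucker_space R d) :=
  [set P | exists2 l, S l & plucker_point l P].

(** * The Cremona transformation and Cremona-affine spans *)

Definition cremona_vec (R : realType) (d : nat) (p : 'rV[R]_d * 'M[R]_d) :
    'rV[R]_d * 'M[R]_d :=
  (\row_i (p.1 0 i)^-1, \matrix_(i, j) (p.2 i j / (p.1 0 i * p.1 0 j))).

(* Graph of the Cremona transformation on the dense open set where all p_{0i}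
   are non-zero. A projective line meeting this set meets it in a dense subset,
   so the restriction does not change closures of images of such lines. *)
Definition cremona (R : realType) (d : nat) (P Q : plucker_space R d) : Prop :=
  exists p, [/\ has_coords P p, forall i, p.1 0 i != 0 &
                has_coords Q (cremona_vec p)].

Definition proj_line (R : realType) (d : nat) (P Q : plucker_space R d) :
    set (plucker_space R d) :=
  [set X | exists p q (a b : R),
    [/\ has_coords P p, has_coords Q q & has_coords X (a *: p + b *: q)]].

Definition LG (R : realType) (d : nat) : set (plucker_space R d) :=
  [set Q | exists2 q, has_coords Q q &
    forall i j k : 'I_d, (i < j < k)%N ->
      q.2 j k - q.2 i k + q.2 i j = 0].

Definition cremona_span (R : realType) (d : nat) (l1 l2 : set 'rV[R]_d) :
    set (plucker_space R d) :=
  closure [set P | exists P1 P2 Q1 Q2 Q,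
    [/\ plucker_point l1 P1 /\ cremona P1 Q1,
        plucker_point l2 P2 /\ cremona P2 Q2,
        (proj_line Q1 Q2 `&` @LG R d) Q & cremona Q P]].

(* An interval is one of the connected pieces into which the two points of E
   divide the curve G, together with these end points. *)
Definition interval_on (T : topologicalType) (G E I : set T) : Prop :=
  exists2 p, (G `\` E) p & I = connected_component (G `\` E) p `|` E.

Definition ascending_interval (R : realType) (d : nat) (l1 l2 : set 'rV[R]_d)
    (I : set (plucker_space R d)) : Prop :=
  interval_on (cremona_span l1 l2) (plucker_image [set l1; l2]) I /\
  I `<=` plucker_image [set l | ascending l].

(** * Spans of direction vectors in the hyperplane at infinity of P^d *)

Definition at_infinity (R : realType) (d : nat) (v : 'rV[R]_d) :
    'rV[R]_(1 + d) := row_mx 0 v.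

Definition span_avoids_codim2 (R : realType) (d : nat) (v1 v2 : 'rV[R]_d) :
    Prop :=
  forall a b : R, let z := a *: at_infinity v1 + b *: at_infinity v2 in
    z != 0 ->
    forall i j : 'I_d, (i < j)%N ->
      ~ (z 0 (rshift 1 i) = 0 /\ z 0 (rshift 1 j) = 0).

(* Main.v *)
Require Import Defs.
From mathcomp Require Import all_boot all_order all_algebra.
From mathcomp Require Import all_classical all_reals all_analysis.
From mathcomp Require Import ring lra.
Import Order.TTheory GRing.Theory Num.Theory.
Import numFieldNormedType.Exports.
Local Open Scope classical_set_scope.
Local Open Scope ring_scope.

(**
Write q_i for the linear coordinates (w, y_k - y_l) of the line l_i, so that the
span consists of limits of the lines C(a q_1 + b q_2).

Interval.  The points with a, b > 0 form a connected set K.  On the points of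
the span having all p_{0k} of one sign, a and b are, up to common factors,
polynomials in the Plücker coordinates; hence K is open in the span minus the
two end points, and bounds on w_k / w_l and |y_k - y_l| / w_k, which persist
in the limit, show that it is closed there, so K is a component.  An ascending
line off K has a b < 0; moving along C(q_1 - t q_2) until the first w_k
vanishes, one reaches in its component a point of the span that is not an
ascending line.

Frame hull.  A line meets a box iff some T satisfies a_k w_k <= y_k + T <= b_k w_k
for all k, a condition which is convex in (y, w).  Conversely, if l meets every
box spanned by a point of l_1 and a point of l_2, then for all k <> m the vector
(w_k, w_m, y_k - y_m) of l is a nonnegative combination of those of l_1 and l_2.
If l_1 and l_2 are disjoint, the coefficients do not depend on k, m: with Z = w_1 y_2 - w_2 y_1
(coordinatewise), for any three indices
det(w, w_1, w_2) * det(Z, w_1, w_2) = 0, and Z lies in the span of w_1 and w_2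
exactly when l_1 and l_2 meet.
*)

(** * Combining conditions on pairs of coordinates *)

Section FrameAlgebra.
Set Implicit Arguments.
Unset Strict Implicit.
Context {R : realType}.

(** Planar linear programming duality. As (a1, b1) and (a2, b2) are independent, x a - y b equals s
    u + t v, where the values u and v of the other two functionals can be prescribed freely. Being
    bounded on the quadrant u <= c1, v <= c2 forces s, t >= 0, and the corner of the quadrant gives
    the last inequality. *)
Lemma cone_of_dual (a1 b1 c1 a2 b2 c2 a b c : R) :
  let D := a1 * b2 - b1 * a2 in
  let s := (a * b2 - b * a2) / D in let t := (a1 * b - b1 * a) / D in
  D != 0 ->
  (forall x y, x * a1 - y * b1 <= c1 -> x * a2 - y * b2 <= c2 ->
     x * a - y * b <= c) ->
  [/\ 0 <= s, 0 <= t & s * c1 + t * c2 <= c].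
Proof.
move=> D s t D0 H.
have {}H u v : u <= c1 -> v <= c2 -> s * u + t * v <= c.
  move=> uc vc.
  have := H ((u * b2 - v * b1) / D) ((u * a2 - v * a1) / D).
  have -> : (u * b2 - v * b1) / D * a1 - (u * a2 - v * a1) / D * b1 = u.
    by rewrite /D; field.
  have -> : (u * b2 - v * b1) / D * a2 - (u * a2 - v * a1) / D * b2 = v.
    by rewrite /D; field.
  have -> : (u * b2 - v * b1) / D * a - (u * a2 - v * a1) / D * b =
            s * u + t * v by rewrite /s /t /D; field.
  exact.
have Hc := H c1 c2 (lexx _) (lexx _).
have slope r : (forall e, 0 <= e -> s * c1 + t * c2 - r * e <= c) -> 0 <= r.
  move=> Hr; rewrite leNgt; apply/negP => r0.
  have rn : - r != 0 by rewrite oppr_eq0 lt_eqF.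
  (* For negative [r] this value of [e] makes the left-hand side equal to c + 1. *)
  have := Hr ((c - (s * c1 + t * c2) + 1) / - r).
  rewrite divr_ge0 ?oppr_ge0 ?(ltW r0) //; last by lra.
  have -> : r * ((c - (s * c1 + t * c2) + 1) / - r) =
      - (c - (s * c1 + t * c2) + 1) by field; rewrite lt_eqF.
  by move=> /(_ isT); lra.
split=> //; apply: slope => e e0.
- by have := H (c1 - e) c2; rewrite lexx; lra.
- by have := H c1 (c2 - e); rewrite lexx; lra.
Qed.

Variables (d : nat) (w1 w2 y1 y2 w y : 'I_d -> R).
Let D i j := w1 i * w2 j - w1 j * w2 i.

(** Adding the pair relations around a triangle of indices eliminates y and leaves a product of two
    determinants equal to 0. Which factor vanishes may depend on the triple, so one triple i, j, k
    with nonzero [Z] factor serves as a pivot for all other indices. *)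
Lemma span_of_pairs (i j : 'I_d) :
  i != j -> (forall k l, k != l -> D k l != 0) ->
  (forall T1 T2, exists k, w2 k * (y1 k + T1) != w1 k * (y2 k + T2)) ->
  (forall k l, k != l -> D k l * (y k - y l) =
     (w k * w2 l - w l * w2 k) * (y1 k - y1 l) +
     (w1 k * w l - w1 l * w k) * (y2 k - y2 l)) ->
  forall k, D i j * w k =
    (w i * w2 j - w j * w2 i) * w1 k + (w1 i * w j - w1 j * w i) * w2 k.
Proof.
move=> ij Dn0 skew Hy.
pose Z k := w1 k * y2 k - w2 k * y1 k.
pose det3 (u : 'I_d -> R) k l m := u k * D l m + u l * D m k + u m * D k l.
have key k l m : k != l -> l != m -> m != k ->
    det3 w k l m * det3 Z k l m = 0.
  move=> kl lm mk.
  (* The three differences telescope; the factors [D] let [Hy] apply to each of them. *)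
  have <- : D k l * D l m * D m k * ((y k - y l) + (y l - y m) + (y m - y k))
    = 0 by ring.
  have -> : D k l * D l m * D m k * (y k - y l + (y l - y m) + (y m - y k)) =
     D l m * D m k * (D k l * (y k - y l)) +
     D k l * D m k * (D l m * (y l - y m)) +
     D k l * D l m * (D m k * (y m - y k)) by ring.
  by rewrite !Hy // /det3 /Z /D; ring.
(* [A] and [B] are the Cramer coefficients of [Z] on [w1] and [w2], read off at i and j. By [skew]
   with T1 = B and T2 = -A, the relation Z k = A w1 k + B w2 k fails for some k, which means that
   [f k] is nonzero. *)
pose A := (Z i * w2 j - Z j * w2 i) / D i j.
pose B := (w1 i * Z j - w1 j * Z i) / D i j.
have Dij := Dn0 _ _ ij.
have [k fk] := skew B (- A).
pose f l := det3 Z i j l.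
have fkn : f k != 0.
  apply: contra fk => /eqP fk; rewrite -subr_eq0; apply/eqP.
  have -> : w2 k * (y1 k + B) - w1 k * (y2 k - A) = - f k / D i j.
    by rewrite /f /det3 /A /B /Z; move: Dij; rewrite /D => Dij; field.
  by rewrite fk oppr0 mul0r.
pose e l := det3 w i j l.
suff e0 l : e l = 0.
  move=> l; apply/eqP; rewrite -subr_eq0; apply/eqP; rewrite -(e0 l) /e /det3 /D.
  ring.
have ji : j != i by rewrite eq_sym.
have [->|il] := eqVneq l i; first by rewrite /e /det3 /D; ring.
have [->|jl] := eqVneq l j; first by rewrite /e /det3 /D; ring.
have li : i != l by rewrite eq_sym.
have lj : j != l by rewrite eq_sym.
(* If [f l] = 0, the triple i, j, l says nothing about [e l]. The triple i, k, l is used instead;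
   its determinants are combinations of those of i, j, k and i, j, l. *)
have [fl|fl] := eqVneq (f l) 0; last first.
  by have /eqP := key i j l ij lj il; rewrite mulf_eq0 (negPf fl) orbF => /eqP.
have ki : k != i.
  by apply: contra fkn => /eqP ->; rewrite /f /det3 /D; apply/eqP; ring.
have kj : k != j.
  by apply: contra fkn => /eqP ->; rewrite /f /det3 /D; apply/eqP; ring.
have kl : k != l by apply: contra fkn => /eqP ->; rewrite fl.
have ik : i != k by rewrite eq_sym.
have jk : j != k by rewrite eq_sym.
have ek : e k = 0.
  by have /eqP := key i j k ij jk ki; rewrite mulf_eq0 (negPf fkn) orbF => /eqP.
have Zikl : det3 Z i k l != 0.
  have -> : det3 Z i k l = f k * D l i / D i j + f l * D i k / D i j.
    by rewrite /f /det3 /Z; move: Dij; rewrite /D => Dij; field.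
  by rewrite fl mul0r mul0r addr0 !mulf_neq0 ?invr_eq0 ?Dn0.
have /eqP := key i k l ik kl il; rewrite mulf_eq0 (negPf Zikl) orbF => /eqP.
have -> : det3 w i k l = e k * D l i / D i j + e l * D i k / D i j.
  by rewrite /e /det3; move: Dij; rewrite /D => Dij; field.
rewrite ek !mul0r add0r => /eqP; rewrite !mulf_eq0 invr_eq0.
by rewrite (negPf (Dn0 _ _ ik)) (negPf Dij) !orbF => /eqP.
Qed.

End FrameAlgebra.

(** * Topology of Plücker space *)

Section PluckerTopology.
Set Implicit Arguments.
Unset Strict Implicit.
Local Open Scope quotient_scope.
Context {R : realType} {d : nat}.
Notation coords := ('rV[R]_d * 'M[R]_d)%type.
Notation PP := (plucker_space R d).

Let pt (p : coords) (np : p \in @nonzero_pcoords R d) :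
  set_type (@nonzero_pcoords R d) :=
  exist (fun x => x \in @nonzero_pcoords R d) p np.

Lemma has_coords_nonzero (P : PP) (p : coords) :
  has_coords P p -> nonzero_pcoords p.
Proof. by move=> [u <- _]; exact: set_mem (valP u). Qed.

Lemma has_coords_ex (P : PP) : exists p : coords, has_coords P p.
Proof. by exists (set_val (repr P)), (repr P); rewrite ?reprK. Qed.

Lemma has_coordsZ (P : PP) (p p' : coords) : has_coords P p ->
  has_coords P p' <-> exists2 c, c != 0 & p' = c *: p.
Proof.
move=> [u <- ->]; split=> [[v <- /eqP]|[c c0 ->]].
  by rewrite eq_sym => /eqP/eqquotP/asboolP.
have [un u0] := set_mem (valP u).
have cu : c *: set_val u \in @nonzero_pcoords R d.
  apply/mem_set; split.
    rewrite /= linearZ /= un.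
    by rewrite scalerN.
  move=> /eqP; rewrite scaler_eq0 (negPf c0) /= => /eqP; exact: u0.
exists (pt cu) => //; apply/eqquotP/asboolP; exists c^-1.
  by rewrite invr_eq0.
by rewrite /= scalerA mulVf // scale1r.
Qed.

Lemma has_coordsZ1 (P : PP) (p : coords) (k : R) :
  k != 0 -> has_coords P p -> has_coords P (k *: p).
Proof. by move=> k0 Pp; apply/(has_coordsZ _ Pp); exists k. Qed.

Lemma has_coords_pt (p : coords) :
  nonzero_pcoords p -> exists P : PP, has_coords P p.
Proof.
by move=> /mem_set pn; exists (\pi_PP (pt pn)), (pt pn).
Qed.

(** The preimage under the quotient map is the trace of the union of all rescalings of [U] by
    nonzero factors. *)
Lemma open_coords (U : set coords) :
  open U -> open [set P : PP | exists2 p, has_coords P p & U p].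
Proof.
move=> oU; rewrite /open /= /quotient_open.
have -> : \pi_PP @^-1` [set P : PP | exists2 p, has_coords P p & U p] =
   set_val @^-1` (\bigcup_(c in [set c : R | c != 0]) ( *:%R c @^-1` U)).
  apply/seteqP; split=> u /=.
    move=> [p]; have uu : has_coords (\pi_PP u) (set_val u) by exists u.
    by move=> /(has_coordsZ _ uu) [c c0 ->] Up; exists c.
  move=> [c /= c0 Uc]; exists (c *: set_val u) => //.
  by apply/(@has_coordsZ _ (set_val u)); [exists u|exists c].
exists (\bigcup_(c in [set c : R | c != 0]) ( *:%R c @^-1` U)) => //.
apply: bigcup_open => c _; apply: open_comp => // p _.
exact: scaler_continuous.
Qed.

Lemma closed_coords (F : set coords) :
  closed F -> closed [set P : PP | forall p, has_coords P p -> F p].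
Proof.
move=> cF; rewrite (_ : [set P | _] =
    ~` [set P : PP | exists2 p, has_coords P p & (~` F) p]).
  by apply: open_closedC; apply: open_coords; rewrite openC.
apply/seteqP; split=> P /=; first by move=> FP [p /FP].
by move=> nFP p Pp; apply: contrapT => nFp; apply: nFP; exists p.
Qed.

Lemma connected_curve (g : R -> coords) (J : set R) :
  continuous g -> connected J -> (forall t, J t -> nonzero_pcoords (g t)) ->
  connected [set P : PP | exists2 t, J t & has_coords P (g t)].
Proof.
move=> cg cJ nJ; have [->|/set0P [t0 Jt0]] := eqVneq J set0.
  rewrite (_ : [set P | _] = set0); first exact: connected0.
  by apply/seteqP; split=> // P [].
have /mem_set gt0 := nJ _ Jt0.
(* [insubd] makes the lift of the curve total, with a point of the curve as default value. On [J] it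
   agrees with [g], so it is continuous for the subspace topology. *)
pose u t : set_type (@nonzero_pcoords R d) := insubd (pt gt0) (g t).
have uE t : J t -> set_val (u t) = g t.
  by move=> /nJ/mem_set Jt; exact: insubdK.
rewrite (_ : [set P | _] = (\pi_PP \o u) @` J).
  apply: connected_continuous_connected => //.
  move=> t; apply: (@continuous_comp (subspace J)); last exact: pi_continuous.
  apply: continuous_comp_initial t.
  apply: (@subspace_eq_continuous _ _ _ g); last exact: continuous_subspaceT.
  by move=> t /set_mem Jt; rewrite /= uE.
apply/seteqP; split=> P /= [t Jt].
  move=> [v vE ->]; exists t => //; congr (\pi_PP _); apply: val_inj.
  exact: etrans (uE t Jt) (esym vE).
by move=> <-; exists t => //; exists (u t) => //; exact: uE.
Qed.

(** If P were outside [F], the complement of [F] would pull back to the trace of an open set of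
    coordinate vectors containing [g b], hence also some [g t] with t in [J]. *)
Lemma closed_curve_limit (g : R -> coords) (J : set R) (b : R) (F : set PP)
    (P : PP) :
  {for b, continuous g} -> closure J b ->
  (forall t, J t -> nonzero_pcoords (g t)) -> closed F ->
  (forall t P', J t -> has_coords P' (g t) -> F P') ->
  has_coords P (g b) -> F P.
Proof.
move=> cg Jb nJ cF FJ Pgb; apply: contrapT => nFP.
have : open (~` F) by rewrite openC.
rewrite /open /= /quotient_open; move=> [W oW WE].
have Wb : W (g b).
  move: Pgb => [v vE PE]; have : (\pi_PP @^-1` (~` F)) v by rewrite /= -PE.
  by rewrite -WE /= vE.
have /Jb [t [Jt Wt]] : nbhs b (g @^-1` W) by apply: cg; exact: open_nbhs_nbhs.
have /mem_set nt := nJ _ Jt.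
have : (set_val @^-1` W) (pt nt) by [].
rewrite WE /=; apply; apply: FJ Jt _.
by exists (pt nt).
Qed.

End PluckerTopology.

(** * Lines and their Cremona coordinates *)

Section Lines.
Set Implicit Arguments.
Unset Strict Implicit.
Context {R : realType} {d : nat}.
Implicit Types (x v : 'rV[R]_d) (c : 'rV[R]_d * 'rV[R]_d).

Lemma line_throughE x v (t s : R) : s != 0 ->
  line_through (x + t *: v) (s *: v) = line_through x v.
Proof.
move=> s0; apply/seteqP; split=> z /= [r ->].
  by exists (t + r * s); rewrite scalerDl scalerA addrA.
exists ((r - t) / s); rewrite scalerA divfK // -addrA -scalerDl.
by congr (_ + _ *: _); ring.
Qed.

Lemma line_through_inj x v x' v' : v' != 0 ->
  line_through x v = line_through x' v' ->
  exists t s : R, [/\ s != 0, x' = x + t *: v & v' = s *: v].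
Proof.
move=> v0 e.
have [t tE] : line_through x v x' by rewrite e; exists 0; rewrite scale0r addr0.
have [t' t'E] : line_through x v (x' + v') by rewrite e; exists 1; rewrite scale1r.
have vE : v' = (t' - t) *: v.
  by rewrite -[v'](addKr x') t'E tE scalerBl opprD addrACA addNr add0r addrC.
exists t, (t' - t); split=> //.
by apply: contraNneq v0 => s0; rewrite vE s0 scale0r.
Qed.

Lemma is_directionP x v v' : v != 0 ->
  is_direction (line_through x v) v' <-> exists2 s : R, s != 0 & v' = s *: v.
Proof.
move=> v0; split=> [[v'0 [x' /(line_through_inj v'0) [t [s [s0 _ ->]]]]]|].
  by exists s.
move=> [s s0 ->]; split; first by rewrite scaler_eq0 (negPf s0).
by exists x; rewrite -(line_throughE x v 0 s0) scale0r addr0.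
Qed.

(** The inverse of the Cremona coordinates, x_i = y_i / w_i and v_i = 1 / w_i, also meaningful for
    pairs that are not normalized. *)
Definition line_of c : set 'rV[R]_d :=
  line_through (\row_i (c.1 0 i / c.2 0 i)) (\row_i (c.2 0 i)^-1).

Lemma cremona_coordsP (l : set 'rV[R]_d) c : cremona_coords l c <->
  [/\ l = line_of c, forall i, 0 < c.2 0 i, \sum_i c.1 0 i = 0 &
      \sum_i c.2 0 i = 1].
Proof.
split=> [[x [v [-> v0 ->]]]|[lE c0 cy cw]].
  split=> // [|i]; last by rewrite /= mxE invr_gt0.
  rewrite /line_of; congr line_through; apply/rowP => i; rewrite !mxE ?invrK //.
  by rewrite divfK // gt_eqF.
exists (\row_i (c.1 0 i / c.2 0 i)), (\row_i (c.2 0 i)^-1); split=> //.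
  by move=> i; rewrite mxE invr_gt0.
case: c c0 {lE cy cw} => y w /= w0; congr (_, _); apply/rowP => i;
  rewrite !mxE ?invrK //.
by rewrite divfK // gt_eqF.
Qed.

Lemma pos_row_neq0 v i : 0 < v 0 i -> v != 0.
Proof. by move=> vi; apply: contraTneq vi => ->; rewrite mxE ltxx. Qed.

(** The normalization of w excludes d = 0, where the sum would be empty; this supplies an index
    whenever one is needed. *)
Lemma cremona_coords_ord (l : set 'rV[R]_d) c :
  cremona_coords l c -> exists i, 0 < c.2 0 i.
Proof.
move=> /cremona_coordsP [_ c0 _].
case: d c c0 => [c _|n c c0 _]; last by exists ord0.
by rewrite big_ord0 => /eqP; rewrite eq_sym oner_eq0.
Qed.

Lemma ascending_coords (l : set 'rV[R]_d) :
  ascending l -> exists c, cremona_coords l c.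
Proof.
move=> [v [v0 [x lE]] vs].
have {vs} [u [u0 {v0}un {}lE]] : exists u : 'rV[R]_d,
    [/\ forall i, 0 < u 0 i, u != 0 & l = line_through x u].
  case: vs => vs; first by exists v.
  exists (- v); split=> [i||]; rewrite ?oppr_eq0 // ?mxE ?oppr_gt0 //.
  by rewrite lE -(line_throughE x v 0 (s := -1)) ?oppr_eq0 ?oner_eq0 //
    scale0r addr0 scaleN1r.
have d0 : (d%:R : R) != 0.
  rewrite pnatr_eq0; apply: contraNneq un => d0.
  by apply/eqP/rowP => i; have := ltn_ord i; rewrite [X in (_ < X)%N]d0.
(* Replacing u by s u makes the w coordinates sum to 1; the shift by t u below makes the y
   coordinates sum to 0. *)
pose s := \sum_i (u 0 i)^-1.
have s0 : 0 < s.
  have [i _] : exists i, (i \in 'I_d) && (u 0 i != 0).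
    apply/existsP; apply: contraNT un => /existsPn un.
    by apply/eqP/rowP => i; have := un i; rewrite mxE negbK => /eqP.
  rewrite /s (bigD1 i) //= ltr_wpDr ?invr_gt0 // sumr_ge0 // => j _.
  by rewrite invr_ge0 ltW.
pose t := - (\sum_i (x 0 i / u 0 i)) / d%:R.
exists (\row_i ((x + t *: u) 0 i / (s *: u) 0 i), \row_i ((s *: u) 0 i)^-1).
exists (x + t *: u), (s *: u); split=> //=.
- by rewrite line_throughE // gt_eqF.
- by move=> i; rewrite mxE mulr_gt0.
- under eq_bigr => i _.
    rewrite !mxE (_ : _ / _ = s^-1 * (x 0 i / u 0 i + t)); last first.
      by field; rewrite !gt_eqF.
    over.
  rewrite -mulr_sumr big_split /= sumr_const card_ord -(mulr_natr t) /t divfK //.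
  by rewrite subrr mulr0.
- under eq_bigr => i _ do rewrite !mxE invfM.
  by rewrite -mulr_sumr mulVf // gt_eqF.
Qed.

(** Two parametrizations of one line differ by a scaling and a shift, which act on w and y by a
    factor and a translation; the two normalizations make both trivial. *)
Lemma cremona_coords_inj (l : set 'rV[R]_d) c c' :
  cremona_coords l c -> cremona_coords l c' -> c = c'.
Proof.
move=> lc; have [i0 _] := cremona_coords_ord lc.
move: lc => /cremona_coordsP [-> c0 cy cw] /cremona_coordsP [+ c'0 c'y c'w].
have v'0 : (\row_i (c'.2 0 i)^-1) != 0 :> 'rV[R]_d.
  by apply: (pos_row_neq0 (i := i0)); rewrite mxE invr_gt0.
move=> /(line_through_inj v'0) [t [s [s0 /rowP xE /rowP vE]]].
have wE i : c.2 0 i = s * c'.2 0 i.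
  have := vE i; rewrite !mxE => /(congr1 GRing.inv); rewrite invrK => ->.
  by rewrite invfM invrK mulVKf.
have s1 : s = 1.
  by move: cw; under eq_bigr do rewrite wE; rewrite -mulr_sumr c'w mulr1.
have {}wE : c.2 = c'.2 by apply/rowP => i; rewrite wE s1 mul1r.
have yE i : c'.1 0 i = c.1 0 i + t.
  have := xE i; rewrite !mxE -wE -mulrDl => /mulIf; apply.
  by rewrite invr_eq0 gt_eqF.
have t0 : t = 0.
  move: c'y; under eq_bigr do rewrite yE.
  rewrite big_split /= cy add0r sumr_const card_ord => /eqP.
  rewrite mulrn_eq0 => /orP [/eqP d0|/eqP //].
  by have := ltn_ord i0; rewrite [X in (_ < X)%N]d0.
case: c c' wE yE {c0 cy cw c'0 c'y c'w v'0 xE vE} => y w [y' w'] /= -> yE.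
by congr (_, _); apply/rowP => i; rewrite yE t0 addr0.
Qed.

(** If all these minors vanished, the two vectors w would be proportional, and so would their
    coordinatewise inverses, the directions. *)
Lemma different_directions_coords (l1 l2 : set 'rV[R]_d) c1 c2 :
  cremona_coords l1 c1 -> cremona_coords l2 c2 -> different_directions l1 l2 ->
  exists i j, c1.2 0 i * c2.2 0 j - c1.2 0 j * c2.2 0 i != 0.
Proof.
move=> h1; have [i0 _] := cremona_coords_ord h1.
move: h1 => /cremona_coordsP [-> c1p _ _] /cremona_coordsP [-> c2p _ _] dd.
apply: contrapT => np; apply: dd.
have v0 c : (forall i, 0 < c.2 0 i) -> (\row_i (c.2 0 i)^-1) != 0 :> 'rV[R]_d.
  by move=> cp; apply: (pos_row_neq0 (i := i0)); rewrite mxE invr_gt0.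
exists (\row_i (c1.2 0 i)^-1); split; apply/is_directionP; rewrite ?v0 //.
  by exists 1; rewrite ?oner_eq0 ?scale1r.
have n1 i : c1.2 0 i != 0 by rewrite gt_eqF.
have n2 i : c2.2 0 i != 0 by rewrite gt_eqF.
exists (c2.2 0 i0 / c1.2 0 i0); first by rewrite mulf_neq0 // invr_eq0.
apply/rowP => i; rewrite !mxE.
have /eqP : c1.2 0 i * c2.2 0 i0 - c1.2 0 i0 * c2.2 0 i = 0.
  by apply: contrapT => /eqP h; apply: np; exists i, i0.
rewrite subr_eq0 => /eqP e.
have -> : c1.2 0 i0 = c1.2 0 i * c2.2 0 i0 / c2.2 0 i by rewrite e mulfK.
by field; rewrite !n1 !n2.
Qed.

End Lines.

(** * Convex hulls and frame hulls *)

Section Hulls.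
Set Implicit Arguments.
Unset Strict Implicit.
Context {R : realType}.

Lemma convex_hull2 (V : lmodType R) (u v : V) :
  convex_hull [set u; v] =
  [set x | exists s t : R, [/\ 0 <= s, 0 <= t, s + t = 1 & x = s *: u + t *: v]].
Proof.
apply/seteqP; split=> [x|x [s [t [s0 t0 st ->]]]].
  apply: smallest_sub => [y z lambda|y [->|->]]; last 2 first.
  - by exists 1, 0; rewrite ler01 lexx addr0 scale1r scale0r addr0.
  - by exists 0, 1; rewrite ler01 lexx add0r scale1r scale0r add0r.
  move=> /set_mem [s [t [s0 t0 st ->]]] /set_mem [s' [t' [s'0 t'0 st' ->]]].
  have l0 : 0 <= lambda%:num :> R by [].
  have l1 : 0 <= 1 - lambda%:num :> R by rewrite subr_ge0.
  apply/mem_set; exists (lambda%:num * s + (1 - lambda%:num) * s').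
  exists (lambda%:num * t + (1 - lambda%:num) * t').
  rewrite !addr_ge0 ?mulr_ge0 //; split=> //.
    by rewrite addrACA -!mulrDr st st'; ring.
  rewrite /conv /= !scalerDr !scalerA !scalerDl.
  by rewrite addrACA.
move=> A [cA uvA].
have s1 : s <= 1 by rewrite -st lerDl.
have /(_ u v (Itv01 s0 s1)) := cA.
rewrite !inE => /(_ (uvA _ (or_introl erefl)) (uvA _ (or_intror erefl))).
by rewrite (_ : t = 1 - s) // -st addrAC subrr add0r.
Qed.

Context {d : nat} {l1 l2 : set 'rV[R]_d} {c1 c2 : 'rV[R]_d * 'rV[R]_d}.
Hypotheses (lc1 : cremona_coords l1 c1) (lc2 : cremona_coords l2 c2).

Lemma cremona_hull2 (l : set 'rV[R]_d) : cremona_hull [set l1; l2] l <->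
  exists s t : R, [/\ 0 <= s, 0 <= t, s + t = 1 &
    cremona_coords l (s *: c1 + t *: c2)].
Proof.
have cE : \bigcup_(m in [set l1; l2]) cremona_coords m = [set c1; c2].
  apply/seteqP; split=> c.
    move=> [m [->|->] mc]; [left|right];
    by [apply: cremona_coords_inj lc1|apply: cremona_coords_inj lc2].
  by move=> [->|->]; [exists l1 => //; left|exists l2 => //; right].
rewrite /cremona_hull /= cE convex_hull2; split.
  by move=> [c lc [s [t [s0 t0 st ce]]]]; exists s, t; rewrite -ce.
by move=> [s [t [s0 t0 st ce]]]; exists (s *: c1 + t *: c2) => //; exists s, t.
Qed.

End Hulls.

(** * Boxes and frame hulls in Cremona coordinates *)

Section Frames.
Set Implicit Arguments.
Unset Strict Implicit.
Context {R : realType} {d : nat}.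
Implicit Types (c : 'rV[R]_d * 'rV[R]_d).

Lemma box_line_of (a b : 'rV[R]_d) c : (forall i, 0 < c.2 0 i) ->
  box a b `&` line_of c !=set0 <->
  exists T, forall i,
    a 0 i * c.2 0 i <= c.1 0 i + T <= b 0 i * c.2 0 i.
Proof.
move=> c0; have zE T i : (\row_i (c.1 0 i / c.2 0 i) +
    T *: \row_i (c.2 0 i)^-1) 0 i = (c.1 0 i + T) / c.2 0 i.
  by rewrite !mxE mulrDl.
split=> [[z [bz [T zT]]]|[T hT]].
  exists T => i; have := bz i.
  by rewrite zT zE ler_pdivlMr // ler_pdivrMr.
exists (\row_i (c.1 0 i / c.2 0 i) + T *: \row_i (c.2 0 i)^-1); split.
  by move=> i; rewrite zE ler_pdivlMr // ler_pdivrMr.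
by exists T.
Qed.

Variables (l1 l2 : set 'rV[R]_d) (c1 c2 : 'rV[R]_d * 'rV[R]_d).
Hypotheses (lc1 : cremona_coords l1 c1) (lc2 : cremona_coords l2 c2).

Lemma cremona_hull_sub_frame_hull :
  cremona_hull [set l1; l2] `<=` frame_hull l1 l2.
Proof.
move=> l /(cremona_hull2 lc1 lc2) [s [t [s0 t0 st lc]]].
move: lc (lc) lc1 lc2 => /cremona_coordsP [-> cp _ _] [x [v [lE v0 _ _ _]]].
move=> /cremona_coordsP [-> c1p _ _] /cremona_coordsP [-> c2p _ _].
split.
  rewrite lE; exists v; last by left.
  split; last by exists x.
  by have [i _] := cremona_coords_ord lc1; exact: pos_row_neq0 (v0 i).
move=> a b _ /(box_line_of _ _ c1p) [T1 h1] /(box_line_of _ _ c2p) [T2 h2].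
(* The box inequalities are linear in y, w and T together, so the parameters combine with the same
   weights as the lines. *)
apply/box_line_of => //; exists (s * T1 + t * T2) => i; rewrite /= !mxE.
have /andP[h1a h1b] := h1 i; have /andP[h2a h2b] := h2 i.
have := ler_wpM2l s0 h1a; have := ler_wpM2l s0 h1b.
have := ler_wpM2l t0 h2a; have := ler_wpM2l t0 h2b.
by move=> *; apply/andP; split; lra.
Qed.

(** The two hypotheses say that the points of [l1] and [l2] with i-th coordinate x have j-th
    coordinate at most y. The box spanned by these points is degenerate in direction i, so a line
    meeting it satisfies the same bound. *)
Lemma frame_hull_functional (l : set 'rV[R]_d) c (i j : 'I_d) (x y : R) :
  i != j -> cremona_coords l c -> frame_hull l1 l2 l ->
  x * c1.2 0 i - y * c1.2 0 j <= c1.1 0 i - c1.1 0 j ->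
  x * c2.2 0 i - y * c2.2 0 j <= c2.1 0 i - c2.1 0 j ->
  x * c.2 0 i - y * c.2 0 j <= c.1 0 i - c.1 0 j.
Proof.
move=> ij /cremona_coordsP [lE cp _ _] [_]; rewrite lE.
move: lc1 lc2 => /cremona_coordsP [-> c1p _ _] /cremona_coordsP [-> c2p _ _].
move=> fl h1 h2.
(* the box spanned by the points of l1 and l2 with i-th coordinate x *)
pose z c' k := (c'.1 0 k + (x * c'.2 0 i - c'.1 0 i)) / c'.2 0 k.
pose a : 'rV[R]_d := \row_k Num.min (z c1 k) (z c2 k).
pose b : 'rV[R]_d := \row_k Num.max (z c1 k) (z c2 k).
have zi c' : (forall i, 0 < c'.2 0 i) -> z c' i = x.
  by move=> c'p; rewrite /z addrC subrK mulfK // gt_eqF.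
have zK c' k : (forall i, 0 < c'.2 0 i) ->
    z c' k * c'.2 0 k = c'.1 0 k + (x * c'.2 0 i - c'.1 0 i).
  by move=> c'p; rewrite /z divfK // gt_eqF.
have zj c' : (forall i, 0 < c'.2 0 i) ->
    x * c'.2 0 i - y * c'.2 0 j <= c'.1 0 i - c'.1 0 j -> z c' j <= y.
  by move=> c'p h; rewrite /z ler_pdivrMr //; lra.
have [] := fl a b.
- by move=> k; rewrite !mxE ge_min !le_max lexx.
- apply/box_line_of => //; exists (x * c1.2 0 i - c1.1 0 i) => k.
  by rewrite -zK // !mxE !ler_pM2r // ge_min le_max lexx.
- apply/box_line_of => //; exists (x * c2.2 0 i - c2.1 0 i) => k.
  by rewrite -zK // !mxE !ler_pM2r // ge_min le_max lexx !orbT.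
move=> p pP; have /box_line_of-/(_ cp) [T hT] : box a b `&` line_of c !=set0.
  by exists p.
have /andP[hi _] := hT i; have /andP[_ hj] := hT j.
move: hi hj; rewrite !mxE !zi // minxx => hi hj.
suff : c.1 0 j + T <= y * c.2 0 j by lra.
by apply: (le_trans hj); rewrite ler_pM2r // ge_max !zj.
Qed.

Let D k l := c1.2 0 k * c2.2 0 l - c1.2 0 l * c2.2 0 k.

(** Duality is applied to (i, j) and to (j, i). The coefficients are the same in both cases while
    the y differences change sign, so the two inequalities combine to an equality. *)
Lemma frame_hull_pair (l : set 'rV[R]_d) c (i j : 'I_d) :
  D i j != 0 -> cremona_coords l c -> frame_hull l1 l2 l ->
  [/\ 0 <= (c.2 0 i * c2.2 0 j - c.2 0 j * c2.2 0 i) / D i j,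
      0 <= (c1.2 0 i * c.2 0 j - c1.2 0 j * c.2 0 i) / D i j &
      D i j * (c.1 0 i - c.1 0 j) =
      (c.2 0 i * c2.2 0 j - c.2 0 j * c2.2 0 i) * (c1.1 0 i - c1.1 0 j) +
      (c1.2 0 i * c.2 0 j - c1.2 0 j * c.2 0 i) * (c2.1 0 i - c2.1 0 j)].
Proof.
move=> Dij lc fl.
have ij : i != j by apply: contraNneq Dij => ->; rewrite /D subrr.
have ji : j != i by rewrite eq_sym.
have Dji : D j i != 0.
  by rewrite /D -opprB oppr_eq0.
have [s0 t0 le1] := cone_of_dual Dij
  (fun x y => frame_hull_functional ij lc fl (x := x) (y := y)).
have [_ _ le2] := cone_of_dual Dji
  (fun x y => frame_hull_functional ji lc fl (x := x) (y := y)).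
split=> //.
set s := (X in 0 <= X) in s0; set t := (X in 0 <= X) in t0.
have -> : c.1 0 i - c.1 0 j = s * (c1.1 0 i - c1.1 0 j) + t * (c2.1 0 i - c2.1 0 j).
  apply/eqP; rewrite eq_le le1 andbT.
  rewrite -lerN2 opprB; apply: le_trans le2.
  rewrite le_eqVlt; apply/orP; left; apply/eqP; rewrite /s /t.
  move: Dij Dji; rewrite /D => Dij Dji; field.
  by rewrite Dij Dji.
rewrite /s /t; move: Dij; rewrite /D => Dij; field.
exact: Dij.
Qed.

End Frames.

(** * Equality of the frame hull and the Cremona hull *)

Section FrameHull.
Set Implicit Arguments.
Unset Strict Implicit.
Context {R : realType} {d : nat}.
Variables (l1 l2 : set 'rV[R]_d) (c1 c2 : 'rV[R]_d * 'rV[R]_d).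
Hypotheses (lc1 : cremona_coords l1 c1) (lc2 : cremona_coords l2 c2).
Let D k l := c1.2 0 k * c2.2 0 l - c1.2 0 l * c2.2 0 k.

(** Once w is one combination s w1 + t w2 in all coordinates, the coefficients for every pair of
    indices reduce to s and t, so y is the same combination up to a translation. The normalizations
    give s + t = 1 and remove the translation. *)
Lemma frame_hull_cremona (l : set 'rV[R]_d) c (i j : 'I_d) :
  i != j -> (forall k l, k != l -> D k l != 0) ->
  cremona_coords l c -> frame_hull l1 l2 l ->
  (forall k, D i j * c.2 0 k =
    (c.2 0 i * c2.2 0 j - c.2 0 j * c2.2 0 i) * c1.2 0 k +
    (c1.2 0 i * c.2 0 j - c1.2 0 j * c.2 0 i) * c2.2 0 k) ->
  cremona_hull [set l1; l2] l.
Proof.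
move=> ij Dn0 lc fl hw; apply/(cremona_hull2 lc1 lc2).
have Dij := Dn0 _ _ ij.
have [s0 t0 _] := frame_hull_pair lc1 lc2 Dij lc fl.
set s := (X in 0 <= X) in s0; set t := (X in 0 <= X) in t0.
have {hw} wE k : c.2 0 k = s * c1.2 0 k + t * c2.2 0 k.
  by rewrite /s /t mulrAC [X in _ + X]mulrAC -mulrDl -hw mulrC mulKf.
have yE k m : c.1 0 k - c.1 0 m =
    s * (c1.1 0 k - c1.1 0 m) + t * (c2.1 0 k - c2.1 0 m).
  have [->|km] := eqVneq k m; first by rewrite !subrr !mulr0 addr0.
  have [_ _] := frame_hull_pair lc1 lc2 (Dn0 _ _ km) lc fl.
  move=> h; apply: (mulfI (Dn0 _ _ km)); rewrite h !wE /D; ring.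
exists s, t; split=> //.
  move: lc lc1 lc2 => /cremona_coordsP [_ _ _ sw].
  move=> /cremona_coordsP [_ _ _ sw1] /cremona_coordsP [_ _ _ sw2].
  move: sw; under eq_bigr do rewrite wE.
  by rewrite big_split /= -!mulr_sumr sw1 sw2 !mulr1.
suff <- : c = s *: c1 + t *: c2 by [].
move: lc lc1 lc2 => /cremona_coordsP [_ _ sy _].
move=> /cremona_coordsP [_ _ sy1 _] /cremona_coordsP [_ _ sy2 _].
(* The residue [r] is constant by [yE] and has sum 0, hence vanishes. *)
pose r k := c.1 0 k - (s * c1.1 0 k + t * c2.1 0 k).
have rE k : r k = r i by have := yE k i; rewrite /r; lra.
have : \sum_k r k = 0.
  by rewrite sumrB sy big_split /= -!mulr_sumr sy1 sy2 !mulr0 addr0 subrr.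
under eq_bigr do rewrite rE.
rewrite sumr_const card_ord => /eqP; rewrite mulrn_eq0 => /orP[/eqP d0|/eqP ri].
  by have := ltn_ord i; rewrite [X in (_ < X)%N]d0.
rewrite [LHS]surjective_pairing [RHS]surjective_pairing.
congr (_, _); apply/rowP => k; rewrite !mxE; last exact: wE.
by apply/eqP; rewrite -subr_eq0 -/(r k) rE ri.
Qed.

Lemma frame_hull_eq :
  different_directions l1 l2 ->
  d = 2%N \/
   (l1 `&` l2 = set0 /\
    forall v1 v2, is_direction l1 v1 -> is_direction l2 v2 ->
      span_avoids_codim2 v1 v2) ->
  frame_hull l1 l2 = cremona_hull [set l1; l2].
Proof.
move=> dd H; apply/seteqP; split; last exact: cremona_hull_sub_frame_hull lc1 lc2.
move=> l fl; have [asc _] := fl; have [c lc] := ascending_coords asc.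
have [i [j Dij]] := different_directions_coords lc1 lc2 dd.
have ij : i != j by apply: contraNneq Dij => ->; rewrite subrr.
have DC k m : D k m = - D m k by rewrite /D opprB.
case: H => [d2|[dis av]].
  (* In the plane, i and j are the only indices, so the single pair already determines w. *)
  have iorj k : k = i \/ k = j.
    have := ltn_ord i; have := ltn_ord j; have := ltn_ord k; move: ij.
    rewrite [X in (k < X)%N]d2 [X in (j < X)%N]d2 [X in (i < X)%N]d2.
    rewrite -!val_eqE /= => ij kd jd id.
    suff : (k == i) || (k == j) by case/orP=> /eqP; [left|right].
    rewrite -!val_eqE /=; move: ij.
    by move: (val i) (val j) (val k) id jd kd => [|[|[]]] // [|[|[]]] // [|[|[]]].
  apply: (frame_hull_cremona ij) lc fl _ => [k m km|k].
    have [[ki|ki] [mi|mi]] := (iorj k, iorj m);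
      by move: km; rewrite ki mi ?eqxx //= DC oppr_eq0.
  by have [->|->] := iorj k; rewrite /D; ring.
have Dn0 k m : k != m -> D k m != 0.
  wlog : k m / (k < m)%N.
    move=> wl km; have [lt|gt|e] := ltngtP k m; first exact: wl.
    - by rewrite DC oppr_eq0; apply: wl => //; rewrite eq_sym.
    - by move: km; rewrite -val_eqE /= e eqxx.
  move=> km _; apply: contra_notN dd => /eqP D0.
  have := lc1; have := lc2.
  move=> /cremona_coordsP [l2E c2p _ _] /cremona_coordsP [l1E c1p _ _].
  pose v1 : 'rV[R]_d := \row_i (c1.2 0 i)^-1.
  pose v2 : 'rV[R]_d := \row_i (c2.2 0 i)^-1.
  have v1p a : 0 < v1 0 a by rewrite mxE invr_gt0.
  have v2p a : 0 < v2 0 a by rewrite mxE invr_gt0.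
  have v1n := pos_row_neq0 (v1p i).
  have v2n := pos_row_neq0 (v2p i).
  have d1 : is_direction l1 v1 by split=> //; eexists; exact: l1E.
  have d2 : is_direction l2 v2 by split=> //; eexists; exact: l2E.
  (* If [D k m] = 0, this combination of the directions vanishes in both coordinates k and m. By
     hypothesis it must then be zero, which makes the directions proportional. *)
  have := av _ _ d1 d2 (v2 0 k) (- v1 0 k) => /=.
  rewrite /at_infinity !scale_row_mx add_row_mx !scaler0 addr0 => hz.
  exists v1; split=> //; split=> //.
  have v1E : v1 = (v1 0 k / v2 0 k) *: v2.
    apply/eqP; rewrite -subr_eq0; apply: contraT => nz; exfalso.
    apply: (hz _ k m km).
      apply: contra nz; rewrite row_mx_eq0 eqxx /= scaleNr => /eqP/subr0_eq e.
      by rewrite subr_eq0 mulrC -scalerA -e scalerA mulVf ?gt_eqF // scale1r.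
    rewrite !row_mxEr !mxE; split; first by rewrite mulNr mulrC subrr.
    have n1 a : c1.2 0 a != 0 by rewrite gt_eqF.
    have n2 a : c2.2 0 a != 0 by rewrite gt_eqF.
    have -> : (c2.2 0 k)^-1 * (c1.2 0 m)^-1 + - (c1.2 0 k)^-1 * (c2.2 0 m)^-1 =
      D k m / (c1.2 0 k * c1.2 0 m * c2.2 0 k * c2.2 0 m).
      by rewrite /D; field; rewrite !n1 !n2.
    by rewrite D0 mul0r.
  exists (\row_i (c2.1 0 i / c2.2 0 i)); rewrite l2E v1E /line_of -/v2.
  have sn : v1 0 k / v2 0 k != 0 by rewrite mulf_neq0 ?invr_eq0 ?gt_eqF.
  by rewrite -[LHS](line_throughE _ _ 0 sn) scale0r addr0.
apply: (frame_hull_cremona ij Dn0 lc fl) => k.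
apply: (span_of_pairs (y1 := fun k => c1.1 0 k) (y2 := fun k => c2.1 0 k)
  (w1 := fun k => c1.2 0 k) (w2 := fun k => c2.2 0 k)
  (w := fun k => c.2 0 k) (y := fun k => c.1 0 k)) => //.
(* If all these equalities held, (y1 + T1) / w1 = (y2 + T2) / w2, taken coordinatewise, would be a
   common point of the two lines. *)
- move=> T1 T2; apply: contrapT => np.
  suff : (l1 `&` l2) (\row_k ((c1.1 0 k + T1) / c1.2 0 k)) by rewrite dis.
  have := lc1; have := lc2.
  move=> /cremona_coordsP [-> c2p _ _] /cremona_coordsP [-> c1p _ _].
  split; [exists T1|exists T2]; apply/rowP => m; rewrite !mxE mulrDl //.
  rewrite -!mulrDl; apply/eqP.
  have n1 : c1.2 0 m != 0 by rewrite gt_eqF.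
  have n2 : c2.2 0 m != 0 by rewrite gt_eqF.
  rewrite eqr_div // mulrC [X in _ == X]mulrC; apply: contraT => nm.
  by exfalso; apply: np; exists m.
- move=> k' m km.
  by have [_ _ ->] := frame_hull_pair lc1 lc2 (Dn0 _ _ km) lc fl.
Qed.

End FrameHull.

(** * Continuity and polynomial preliminaries *)

Section Continuity.
Set Implicit Arguments.
Unset Strict Implicit.
Context {R : realType}.

Lemma finite_ub (I : finType) (f : I -> R) : exists2 M, 0 < M & forall k, f k <= M.
Proof.
exists (1 + \sum_k `|f k|); first by rewrite ltr_pwDl // sumr_ge0.
move=> k; rewrite (bigD1 k) //= addrCA; apply: (le_trans (ler_norm _)).
by rewrite lerDl addr_ge0 // sumr_ge0.
Qed.

Lemma continuous_mx (T : topologicalType) (m n : nat) (f : T -> 'M[R]_(m, n)) :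
  (forall i j, continuous (fun t => f t i j)) -> continuous f.
Proof.
move=> fc t A [P MP sPA]; rewrite /nbhs /=.
apply: (filterS (P := fun t' => forall i j, P i j (f t' i j))).
  by move=> t' Pt'; exact: sPA.
by do 2![apply: filter_forall => ?]; exact: fc.
Qed.

Context {T : topologicalType}.

Lemma open_positive (I : finType) (f : I -> T -> R) :
  (forall i, continuous (f i)) -> open [set p | forall i, 0 < f i p].
Proof.
move=> fc; rewrite openE => p /= fp; apply: filter_forall => i.
apply: (fc i p [set x | 0 < x]); apply: open_nbhs_nbhs.
by split; [exact: open_gt|exact: fp].
Qed.

Lemma closed_nonnegative (I : Type) (f : I -> T -> R) :
  (forall i, continuous (f i)) -> closed [set p | forall i, 0 <= f i p].
Proof.
move=> fc; rewrite (_ : [set p | _] = \bigcap_i (f i @^-1` [set x | 0 <= x])).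
  apply: closed_bigI => i _; apply: closed_comp; last exact: closed_ge.
  by move=> p _; exact: fc.
by apply/seteqP; split=> p h i; [move=> _|]; exact: h.
Qed.

Lemma closed_zeros (I : Type) (f : I -> T -> R) :
  (forall i, continuous (f i)) -> closed [set p | forall i, f i p = 0].
Proof.
move=> fc; rewrite (_ : [set p | _] = \bigcap_i (f i @^-1` [set x | x = 0])).
  apply: closed_bigI => i _; apply: closed_comp; last exact: closed_eq.
  by move=> p _; exact: fc.
by apply/seteqP; split=> p h i; [move=> _|]; exact: h.
Qed.

Lemma continuous_add (f g : T -> R) :
  continuous f -> continuous g -> continuous (fun p => f p + g p).
Proof. by move=> fc gc p; exact: cvgD (fc p) (gc p). Qed.

Lemma continuous_opp (f : T -> R) : continuous f -> continuous (fun p => - f p).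
Proof. by move=> fc p; exact: cvgN (fc p). Qed.

Lemma continuous_mul (f g : T -> R) :
  continuous f -> continuous g -> continuous (fun p => f p * g p).
Proof. by move=> fc gc p; exact: cvgM (fc p) (gc p). Qed.

Lemma fst_coord_continuous (d : nat) i :
  continuous (fun p : 'rV[R]_d * 'M[R]_d => p.1 0 i).
Proof.
move=> p; apply: (@continuous_comp _ _ _ fst (fun M : 'rV[R]_d => M 0 i)).
  exact: cvg_fst.
exact: coord_continuous.
Qed.

Lemma snd_coord_continuous (d : nat) i j :
  continuous (fun p : 'rV[R]_d * 'M[R]_d => p.2 i j).
Proof.
move=> p; apply: (@continuous_comp _ _ _ snd (fun M : 'M[R]_d => M i j)).
  exact: cvg_snd.
exact: coord_continuous.
Qed.

End Continuity.

(** The exponent n is the least multiplicity of the root [t0] in the family. The induction is on the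
    size of the nonzero member [f a0], which drops whenever all members share the root. *)
Lemma divide_root {F : fieldType} {T : finType} (f : T -> {poly F})
    (t0 : F) (a0 : T) :
  f a0 != 0 ->
  exists n (h : T -> {poly F}),
    (forall a, f a = h a * ('X - t0%:P) ^+ n) /\ exists a, ~~ root (h a) t0.
Proof.
have [N] := ubnP (size (f a0)); elim: N f => // N IH f sN f0.
have [rt|/forallPn [a ra]] := boolP [forall a, root (f a) t0]; last first.
  by exists 0%N, f; split; [move=> b; rewrite expr0 mulr1|exists a].
have fE a : f a = (f a %/ ('X - t0%:P)) * ('X - t0%:P).
  by apply/esym/divpK; rewrite dvdp_XsubCl; exact: (forallP rt).
have q0 : f a0 %/ ('X - t0%:P) != 0.
  by apply: contraNneq f0 => q0; rewrite fE q0 mul0r.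
have [|//|n [h [hE ha]]] := IH (fun a => f a %/ ('X - t0%:P)).
  by move: sN; rewrite {1}fE size_mul ?polyXsubC_eq0 // size_XsubC addn2.
exists n.+1, h; split=> // a; by rewrite exprSr mulrA -hE -fE.
Qed.

(** * The Cremona transformation on lines *)

Lemma pair_ext (S T : Type) (x y : S * T) : x.1 = y.1 -> x.2 = y.2 -> x = y.
Proof. by case: x y => ? ? [? ?] /= -> ->. Qed.

Section CremonaPoints.
Set Implicit Arguments.
Unset Strict Implicit.
Context {R : realType} {d : nat}.
Notation coords := ('rV[R]_d * 'M[R]_d)%type.
Notation PP := (plucker_space R d).
Implicit Types (c : 'rV[R]_d * 'rV[R]_d) (p q : coords).

Lemma scale_pcoords1 (a : R) p i : (a *: p).1 0 i = a * p.1 0 i.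
Proof. by rewrite mxE. Qed.

Lemma scale_pcoords2 (a : R) p i j : (a *: p).2 i j = a * p.2 i j.
Proof. by rewrite mxE. Qed.

(** The parametrization of LG(d) by (y, w). It is linear, so projective lines in LG(d) correspond to
    pencils of pairs (y, w). *)
Definition lg_coords c : coords := (c.2, \matrix_(i, j) (c.1 0 i - c.1 0 j)).

(** For positive w these are Plücker coordinates of [line_of c]. Entries of w of either sign are
    allowed, as required for points of the span that are not ascending lines. *)
Definition cremona_pcoords c : coords := cremona_vec (lg_coords c).

Lemma lg_coords_comb (a b : R) c1 c2 :
  a *: lg_coords c1 + b *: lg_coords c2 = lg_coords (a *: c1 + b *: c2).
Proof.
apply: pair_ext=> //=.
by apply/matrixP => i j; rewrite !mxE /=; ring.
Qed.

Lemma lg_coordsZ (a : R) c : a *: lg_coords c = lg_coords (a *: c).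
Proof. by have := lg_coords_comb a 0 c c; rewrite !scale0r !addr0. Qed.

Lemma cremona_vecZ (k : R) p : k != 0 ->
  cremona_vec (k *: p) = k^-1 *: cremona_vec p.
Proof.
move=> k0; apply: pair_ext=> /=.
  by apply/rowP => i; rewrite !mxE invfM.
apply/matrixP => i j; rewrite !mxE !invfM.
by move: (p.1 0 i)^-1 (p.1 0 j)^-1 => u v; field.
Qed.

Lemma cremona_vecK p : (forall i, p.1 0 i != 0) ->
  cremona_vec (cremona_vec p) = p.
Proof.
move=> p0; apply: pair_ext=> /=.
  by apply/rowP => i; rewrite !mxE invrK.
apply/matrixP => i j; rewrite !mxE; field.
by rewrite !p0.
Qed.

Lemma cremona_pcoordsZ (k : R) c : k != 0 ->
  cremona_pcoords (k *: c) = k^-1 *: cremona_pcoords c.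
Proof. by move=> k0; rewrite /cremona_pcoords -lg_coordsZ cremona_vecZ. Qed.

Lemma cremona_pcoords1 c i : (cremona_pcoords c).1 0 i = (c.2 0 i)^-1.
Proof. by rewrite mxE. Qed.

Lemma cremona_pcoords2 c i j : (cremona_pcoords c).2 i j =
  (c.1 0 i - c.1 0 j) / (c.2 0 i * c.2 0 j).
Proof. by rewrite !mxE. Qed.

Lemma cremona_pcoords_nonzero c i : c.2 0 i != 0 ->
  nonzero_pcoords (cremona_pcoords c).
Proof.
move=> ci; split.
  apply/matrixP => j k; rewrite mxE cremona_pcoords2 [RHS]mxE cremona_pcoords2.
  by rewrite -mulNr opprB mulrC [in RHS]mulrC [c.2 0 k * _]mulrC.
move=> /(congr1 (fun p : coords => p.1 0 i)).
by rewrite cremona_pcoords1 mxE => /eqP; rewrite invr_eq0 (negPf ci).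
Qed.

Lemma plucker_coordsE (x v : 'rV[R]_d) (t s : R) :
  plucker_coords (x + t *: v) (s *: v) = s *: plucker_coords x v.
Proof.
apply: pair_ext=> //=.
by apply/matrixP => i j; rewrite !mxE; ring.
Qed.

Lemma plucker_coords_line_of c : (forall i, 0 < c.2 0 i) ->
  plucker_coords (\row_i (c.1 0 i / c.2 0 i)) (\row_i (c.2 0 i)^-1) =
  cremona_pcoords c.
Proof.
move=> c0; apply: pair_ext=> //=.
apply/matrixP => i j; rewrite !mxE; field.
by rewrite !gt_eqF.
Qed.

Lemma plucker_point_line_of (l : set 'rV[R]_d) c (P : PP) :
  cremona_coords l c -> plucker_point l P <-> has_coords P (cremona_pcoords c).
Proof.
move=> lc; have [i0 _] := cremona_coords_ord lc.
move: lc => /cremona_coordsP [-> c0 _ _].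
split=> [[x [v [v0 /(line_through_inj v0) [t [s [s0 xE vE]]] Pc]]]|Pc].
  rewrite -plucker_coords_line_of //; apply/(has_coordsZ _ Pc); exists s^-1.
    by rewrite invr_eq0.
  by rewrite xE vE plucker_coordsE scalerA mulVf // scale1r.
exists (\row_i (c.1 0 i / c.2 0 i)), (\row_i (c.2 0 i)^-1); split=> //.
  by apply: (pos_row_neq0 (i := i0)); rewrite mxE invr_gt0.
by rewrite plucker_coords_line_of.
Qed.

Lemma plucker_image_ascending (P : PP) :
  plucker_image [set l | ascending l] P ->
  exists2 c, has_coords P (cremona_pcoords c) & forall i, 0 < c.2 0 i.
Proof.
move=> [l /ascending_coords [c lc] /(plucker_point_line_of _ lc) Pc].
by exists c => //; move: lc => /cremona_coordsP [].
Qed.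

End CremonaPoints.

(** * Continuous extension of Cremona images of pencils *)

Section Curve.
Set Implicit Arguments.
Unset Strict Implicit.
Context {R : realType} {d : nat}.
Notation coords := ('rV[R]_d * 'M[R]_d)%type.

(* Clearing denominators in the Cremona image of a line and dividing by the
   common power of (t - t0) extends the curve continuously to t0. *)
Lemma cremona_curve_extension (A B : 'rV[R]_d * 'rV[R]_d) (t0 t1 : R) (i0 : 'I_d) :
  (forall i, (A + t1 *: B).2 0 i != 0) ->
  exists g : R -> coords, [/\ continuous g, nonzero_pcoords (g t0),
    forall t, t != t0 -> (forall i, (A + t *: B).2 0 i != 0) ->
      exists2 k : R, k != 0 & g t = k *: cremona_pcoords (A + t *: B) &
    forall i j, (A + t0 *: B).2 0 i = 0 -> (A + t0 *: B).2 0 j != 0 ->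
      (g t0).1 0 j = 0].
Proof.
move=> w1.
pose W k : {poly R} := (A.2 0 k)%:P + B.2 0 k *: 'X.
pose Y k l : {poly R} := (A.1 0 k - A.1 0 l)%:P + (B.1 0 k - B.1 0 l) *: 'X.
have WE t k : (W k).[t] = (A + t *: B).2 0 k.
  by rewrite /W !hornerE /= !mxE mulrC.
have YE t k l : (Y k l).[t] = (A + t *: B).1 0 k - (A + t *: B).1 0 l.
  by rewrite /Y !hornerE /= !mxE; ring.
(* The Cremona image multiplied by the product [Q] of all w_m: [inl k] stands for p_{0k} and
   [inr (k, l)] for p_{kl}. For k = l the product omits only one factor, which is harmless since
   [Y k k] = 0. *)
pose F (a : 'I_d + 'I_d * 'I_d) : {poly R} := match a with
  | inl k => \prod_(m | m != k) W m
  | inr (k, l) => Y k l * \prod_(m | (m != k) && (m != l)) W m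
  end.
pose Q := \prod_m W m.
have F1 k : W k * F (inl k) = Q by rewrite /F /Q [RHS](bigD1 k).
have F2 k l : W k * W l * F (inr (k, l)) = Y k l * Q.
  rewrite /F; have [->|kl] := eqVneq k l.
    by rewrite /Y !subrr scale0r addr0 !mul0r mulr0.
  have QE : Q = W k * (W l * \prod_(m | (m != k) && (m != l)) W m).
    by rewrite /Q (bigD1 k) //=; congr (_ * _); rewrite (bigD1 l) // eq_sym.
  by rewrite QE; ring.
(* The parameter [t1] shows that no w coordinate vanishes identically along the pencil. *)
have Wt1 k : W k != 0.
  by apply: contra (w1 k) => /eqP W0; rewrite -WE W0 horner0.
have Fi0 : F (inl i0) != 0 by apply/prodf_neq0.
have QE t : Q.[t] = \prod_m (A + t *: B).2 0 m.
  by rewrite /Q horner_prod; apply: eq_bigr => m _; rewrite WE.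
clearbody F Q.
have [n [H [HE [a ra]]]] := divide_root t0 Fi0.
have X0 : ('X - t0%:P) ^+ n != 0 by rewrite expf_neq0 // polyXsubC_eq0.
pose g t : coords := (\row_k (H (inl k)).[t], \matrix_(k, l) (H (inr (k, l))).[t]).
(* Both sides were [Q] before the division. At [t0], a vanishing w_i therefore forces p_{0j} = 0
   wherever w_j is nonzero. *)
have H1 k l : W k * H (inl k) = W l * H (inl l).
  by apply: (mulIf X0); rewrite -!mulrA -!HE !F1.
have HN k l : H (inr (l, k)) = - H (inr (k, l)).
  apply: (mulIf X0); rewrite mulNr -!HE; apply: (mulfI (Wt1 k)).
  apply: (mulfI (Wt1 l)); rewrite mulrA F2 [RHS]mulrA [W l * W k]mulrC.
  rewrite mulrN F2 -mulNr; congr (_ * _).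
  by rewrite /Y opprD -polyCN -scaleNr !opprB.
have gN t : (g t).2^T = - (g t).2.
  by apply/matrixP => k l; rewrite !mxE HN hornerN.
exists g; split.
- have g1c : continuous (fun t => (g t).1).
    apply: continuous_mx => i j; rewrite (_ : (fun t => _) = horner (H (inl j))).
      exact: continuous_horner.
    by apply/funext => s; rewrite mxE.
  have g2c : continuous (fun t => (g t).2).
    apply: continuous_mx => i j.
    rewrite (_ : (fun t => _) = horner (H (inr (i, j)))).
      exact: continuous_horner.
    by apply/funext => s; rewrite mxE.
  move=> t; exact: cvg_pair (g1c t) (g2c t).
- split=> // g0; move: ra; rewrite /root; apply/negP; rewrite negbK; apply/eqP.
  case: a => [k|[k l]].
    by have := congr1 (fun p : coords => p.1 0 k) g0; rewrite /= !mxE.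
  by have := congr1 (fun p : coords => p.2 k l) g0; rewrite /= !mxE.
- move=> t tt0 wt.
  have r0 : (t - t0) ^+ n != 0 by rewrite expf_neq0 // subr_eq0.
  have HtE b : (H b).[t] = (F b).[t] / (t - t0) ^+ n.
    by rewrite HE !hornerE mulfK.
  have Q0 : Q.[t] != 0.
    by rewrite QE; apply/prodf_neq0 => m _.
  exists (Q.[t] / (t - t0) ^+ n); first by rewrite mulf_neq0 // invr_eq0.
  apply: pair_ext.
    apply/rowP => k; rewrite mxE HtE scale_pcoords1 cremona_pcoords1.
    rewrite -(F1 k) hornerM WE mulrAC; congr (_ / _).
    by rewrite mulrC mulKf.
  apply/matrixP => k l; rewrite mxE HtE scale_pcoords2 cremona_pcoords2.
  have := congr1 (horner^~ t) (F2 k l); rewrite !hornerM !WE YE => h.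
  have wkl := mulf_neq0 (wt k) (wt l).
  rewrite mulrAC; congr (_ / _).
  by rewrite mulrA [Q.[t] * _]mulrC -h mulrC mulKf.
- move=> i j wi wj; rewrite mxE.
  have := congr1 (horner^~ t0) (H1 j i); rewrite /= !hornerM !WE wi mul0r.
  by move=> /eqP; rewrite mulf_eq0 (negPf wj) => /eqP.
Qed.

End Curve.

(** * The Cremona-affine span *)

Section Span.
Set Implicit Arguments.
Unset Strict Implicit.
Context {R : realType} {d : nat}.
Notation coords := ('rV[R]_d * 'M[R]_d)%type.
Notation PP := (plucker_space R d).
Implicit Types (c : 'rV[R]_d * 'rV[R]_d) (p q : coords) (P : PP).

(** The Cremona image of the line in LG(d) through the two given points, restricted to the locus of
    nonzero w_i on which [cremona] is defined. *)
Definition pencil_image c1 c2 : set PP :=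
  [set P | exists a b : R, (forall i, (a *: c1 + b *: c2).2 0 i != 0) /\
     has_coords P (cremona_pcoords (a *: c1 + b *: c2))].

Lemma cremona_of_pcoords P Q c : has_coords P (cremona_pcoords c) ->
  (forall i, c.2 0 i != 0) -> cremona P Q <-> has_coords Q (lg_coords c).
Proof.
move=> Pc c0; have cK : cremona_vec (cremona_pcoords c) = lg_coords c.
  by apply: cremona_vecK.
split=> [[p [/(has_coordsZ _ Pc) [k k0 ->] _]]|Qc].
  rewrite cremona_vecZ // cK => /(has_coordsZ1 k0).
  by rewrite scalerA mulfV // scale1r.
exists (cremona_pcoords c); split=> //; last by rewrite cK.
by move=> i; rewrite cremona_pcoords1 invr_eq0.
Qed.

Lemma cremona_of_lg Q P c : has_coords Q (lg_coords c) -> cremona Q P <->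
  (forall i, c.2 0 i != 0) /\ has_coords P (cremona_pcoords c).
Proof.
move=> Qc; split=> [[q [/(has_coordsZ _ Qc) [k k0 ->] q0]]|[c0 Pc]].
  rewrite cremona_vecZ // => /(has_coordsZ1 k0).
  rewrite scalerA mulfV // scale1r; split=> // i.
  by have := q0 i; rewrite scale_pcoords1 mulf_eq0 negb_or => /andP[].
by exists (lg_coords c).
Qed.

Lemma lg_coords_LG Q c : has_coords Q (lg_coords c) -> @LG R d Q.
Proof. by move=> Qc; exists (lg_coords c) => // i j k _; rewrite !mxE; ring. Qed.

Lemma cremona_spanE (l1 l2 : set 'rV[R]_d) c1 c2 :
  cremona_coords l1 c1 -> cremona_coords l2 c2 ->
  cremona_span l1 l2 = closure (pencil_image c1 c2).
Proof.
move=> lc1 lc2; have [i0 _] := cremona_coords_ord lc1.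
have [_ c1p _ _] := (cremona_coordsP _ _).1 lc1.
have [_ c2p _ _] := (cremona_coordsP _ _).1 lc2.
have c1n i : c1.2 0 i != 0 by rewrite gt_eqF.
have c2n i : c2.2 0 i != 0 by rewrite gt_eqF.
congr closure; apply/seteqP; split=> P.
  move=> [P1 [P2 [Q1 [Q2 [Q [[lP1 PQ1] [lP2 PQ2] [QL _] QP]]]]]].
  move: lP1 => /(plucker_point_line_of _ lc1) P1c.
  move: lP2 => /(plucker_point_line_of _ lc2) P2c.
  move: PQ1 => /(cremona_of_pcoords _ P1c c1n) Q1c.
  move: PQ2 => /(cremona_of_pcoords _ P2c c2n) Q2c.
  move: QL => [p [q [a [b []]]]].
  move=> /(has_coordsZ _ Q1c) [k1 k10 ->] /(has_coordsZ _ Q2c) [k2 k20 ->].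
  rewrite !scalerA lg_coords_comb => Qc.
  by move: QP => /(cremona_of_lg _ Qc) ?; exists (a * k1), (b * k2).
move=> [a [b [w0 Pc]]].
have [P1 P1c] := has_coords_pt (cremona_pcoords_nonzero (c1n i0)).
have [P2 P2c] := has_coords_pt (cremona_pcoords_nonzero (c2n i0)).
have nz c : c.2 0 i0 != 0 -> nonzero_pcoords (lg_coords c).
  move=> ci; split.
    by apply/matrixP => j k; rewrite !mxE opprB.
  move=> /(congr1 (fun p : coords => p.1 0 i0)) /= /eqP.
  by rewrite mxE (negPf ci).
have [Q1 Q1c] := has_coords_pt (nz _ (c1n i0)).
have [Q2 Q2c] := has_coords_pt (nz _ (c2n i0)).
have [Q Qc] := has_coords_pt (nz _ (w0 i0)).
exists P1, P2, Q1, Q2, Q; split.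
- by split; [apply/(plucker_point_line_of _ lc1)|apply/(cremona_of_pcoords _ P1c)].
- by split; [apply/(plucker_point_line_of _ lc2)|apply/(cremona_of_pcoords _ P2c)].
- split; last exact: lg_coords_LG Qc.
  by exists (lg_coords c1), (lg_coords c2), a, b; rewrite lg_coords_comb.
- by apply/(cremona_of_lg _ Qc).
Qed.

(** The Cremona map is homogeneous of degree -1, so a change of representative is absorbed into a
    and b. Every coordinate vector of P thus has this form exactly, not only up to scale. *)
Lemma pencil_imageP c1 c2 P p : pencil_image c1 c2 P -> has_coords P p ->
  exists a b : R, (forall i, (a *: c1 + b *: c2).2 0 i != 0) /\
    p = cremona_pcoords (a *: c1 + b *: c2).
Proof.
move=> [a [b [w0 Pc]]] /(has_coordsZ _ Pc) [k k0 ->].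
have cE : (k^-1 * a) *: c1 + (k^-1 * b) *: c2 = k^-1 *: (a *: c1 + b *: c2).
  by rewrite scalerDr !scalerA.
exists (k^-1 * a), (k^-1 * b); rewrite cE; split.
  by move=> i; rewrite mxE mulf_neq0 // invr_eq0.
by rewrite cremona_pcoordsZ ?invr_eq0 // invrK.
Qed.

Lemma comb_w (a b : R) c1 c2 i :
  (a *: c1 + b *: c2).2 0 i = a * c1.2 0 i + b * c2.2 0 i.
Proof. by rewrite !mxE. Qed.

Lemma comb_y (a b : R) c1 c2 i :
  (a *: c1 + b *: c2).1 0 i = a * c1.1 0 i + b * c2.1 0 i.
Proof. by rewrite !mxE. Qed.

Section TwoPoints.
Variables (c1 c2 : 'rV[R]_d * 'rV[R]_d) (i j : 'I_d).
Hypotheses (c1p : forall i, 0 < c1.2 0 i) (c2p : forall i, 0 < c2.2 0 i).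
Let D := c1.2 0 i * c2.2 0 j - c1.2 0 j * c2.2 0 i.
Hypothesis D0 : D != 0.
Let G := closure (pencil_image c1 c2).
Let E : set PP :=
  [set P | has_coords P (cremona_pcoords c1) \/ has_coords P (cremona_pcoords c2)].

(* By Cramer's rule, the Cremona image of p is alpha p * q_1 + beta p * q_2
   up to the common factor p_{0i} p_{0j} D. *)
Let alpha p := p.1 0 j * c2.2 0 j - p.1 0 i * c2.2 0 i.
Let beta p := c1.2 0 i * p.1 0 i - c1.2 0 j * p.1 0 j.

Let alphaE (a b : R) : (forall i, (a *: c1 + b *: c2).2 0 i != 0) ->
  let p := cremona_pcoords (a *: c1 + b *: c2) in
  alpha p = a * D * (p.1 0 i * p.1 0 j).
Proof.
move=> w0 p; rewrite /alpha !cremona_pcoords1.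
move: (w0 i) (w0 j); rewrite !comb_w /D => wi wj; field.
by rewrite wi wj.
Qed.

Let betaE (a b : R) : (forall i, (a *: c1 + b *: c2).2 0 i != 0) ->
  let p := cremona_pcoords (a *: c1 + b *: c2) in
  beta p = b * D * (p.1 0 i * p.1 0 j).
Proof.
move=> w0 p; rewrite /beta !cremona_pcoords1.
move: (w0 i) (w0 j); rewrite !comb_w /D => wi wj; field.
by rewrite wi wj.
Qed.

(** As z is a nonzero square, the sign of [alpha p * beta p] is that of a b; it tells the two arcs
    of the span apart. *)
Let alpha_betaE (a b : R) : (forall i, (a *: c1 + b *: c2).2 0 i != 0) ->
  let p := cremona_pcoords (a *: c1 + b *: c2) in
  exists2 z, 0 < z & alpha p * beta p = a * b * z.
Proof.
move=> w0 p; exists ((D * (p.1 0 i * p.1 0 j)) ^+ 2).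
  by rewrite lt_neqAle sqr_ge0 eq_sym expf_neq0 ?mulf_neq0 // /p
    cremona_pcoords1 invr_eq0.
by rewrite alphaE // betaE //= -/p; ring.
Qed.

Let cont1 := @fst_coord_continuous R d.
Let cont2 := @snd_coord_continuous R d.

Local Ltac continuous_expr := repeat lazymatch goal with
  | |- continuous (fun q => @?f q + @?g q) => apply: (@continuous_add _ _ f g)
  | |- continuous (fun q => - @?f q) => apply: (@continuous_opp _ _ f)
  | |- continuous (fun q => @?f q * @?g q) => apply: (@continuous_mul _ _ f g)
  | |- continuous (fun q => q.1 0 ?k) => exact: cont1
  | |- continuous (fun q => q.2 ?k ?l) => exact: cont2
  | |- continuous (fun q => alpha q) => assumption
  | |- continuous (fun q => beta q) => assumption
  | |- continuous (fun=> ?c) => exact: cst_continuous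
  end.

(** Taking the closure adds no points with all p_{0k} positive: the pencil satisfies polynomial
    equations that persist in the closure and, where no p_{0k} vanishes, can be solved for a and
    b. *)
Lemma closure_pencil_pos P p : G P -> has_coords P p -> (forall k, 0 < p.1 0 k) ->
  exists a b : R, (forall k, 0 < (a *: c1 + b *: c2).2 0 k) /\
    p = cremona_pcoords (a *: c1 + b *: c2).
Proof.
move=> GP Pp pp.
(* With a and b expressed through [alpha] and [beta], these are the equations for w_k and for y_k -
   y_l, cleared of denominators. *)
pose f (k : 'I_d) (p : coords) :=
  D * p.1 0 i * p.1 0 j - (alpha p * c1.2 0 k + beta p * c2.2 0 k) * p.1 0 k.
pose h' (k l : 'I_d) (p : coords) := D * p.2 k l * p.1 0 i * p.1 0 j -
  (alpha p * (c1.1 0 k - c1.1 0 l) + beta p * (c2.1 0 k - c2.1 0 l))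
  * p.1 0 k * p.1 0 l.
pose h (kl : 'I_d * 'I_d) := h' kl.1 kl.2.
have ca : continuous alpha.
  by rewrite /alpha; continuous_expr.
have cb : continuous beta.
  by rewrite /beta; continuous_expr.
have fc k : continuous (f k).
  by rewrite /f; continuous_expr.
have hc k : continuous (h k).
  by rewrite /h /h'; continuous_expr.
have cF := closed_coords (closedI (closed_zeros fc) (closed_zeros hc)).
have SF : pencil_image c1 c2 `<=` [set P : PP | forall p, has_coords P p ->
    ([set p | forall k, f k p = 0] `&` [set p | forall k, h k p = 0]) p].
  move=> P' SP' p' /(pencil_imageP SP') [a [b [w0 ->]]]; split=> /=.
    move=> k; rewrite /f alphaE // betaE // !cremona_pcoords1.
    move: (w0 i) (w0 j) (w0 k); rewrite !comb_w => wi wj wk.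
    by field; rewrite wi wj wk.
  move=> [k l]; rewrite /h /= /h' alphaE // betaE //.
  rewrite !cremona_pcoords1 cremona_pcoords2.
  move: (w0 i) (w0 j) (w0 k) (w0 l); rewrite !comb_w !comb_y => wi wj wk wl.
  by field; rewrite wi wj wk wl.
have [f0 h0] : ([set p | forall k, f k p = 0] `&` [set p | forall k, h k p = 0]) p.
  by have := closureS SF GP; rewrite -((closure_id _).1 cF); apply.
have n k : p.1 0 k != 0 by rewrite gt_eqF.
pose a := alpha p / (D * p.1 0 i * p.1 0 j).
pose b := beta p / (D * p.1 0 i * p.1 0 j).
have wE k : (a *: c1 + b *: c2).2 0 k = (p.1 0 k)^-1.
  rewrite comb_w /a /b; apply: (mulIf (n k)); rewrite mulVf //.
  have /subr0_eq e := f0 k.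
  have -> : (alpha p / (D * p.1 0 i * p.1 0 j) * c1.2 0 k +
    beta p / (D * p.1 0 i * p.1 0 j) * c2.2 0 k) * p.1 0 k =
    ((alpha p * c1.2 0 k + beta p * c2.2 0 k) * p.1 0 k) / (D * p.1 0 i * p.1 0 j).
    by field; rewrite D0 !n.
  by rewrite -e mulfV // !mulf_neq0.
exists a, b; split; first by move=> k; rewrite wE invr_gt0.
apply: pair_ext; first by apply/rowP => k; rewrite cremona_pcoords1 wE invrK.
apply/matrixP => k l; rewrite cremona_pcoords2 !wE !comb_y.
have /subr0_eq e := h0 (k, l); rewrite /= in e.
apply/esym; have -> : (a * c1.1 0 k + b * c2.1 0 k - (a * c1.1 0 l + b * c2.1 0 l)) /
    ((p.1 0 k)^-1 * (p.1 0 l)^-1) =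
  (alpha p * (c1.1 0 k - c1.1 0 l) + beta p * (c2.1 0 k - c2.1 0 l)) *
    p.1 0 k * p.1 0 l / (D * p.1 0 i * p.1 0 j).
  by rewrite /a /b; field; rewrite D0 !n.
by rewrite -e; field; rewrite D0 !n.
Qed.

(** Proportionality of a w1 + b w2 to w1 would give b D = 0, and to w2 it would give a D = 0. *)
Lemma not_end P (a b : R) : a != 0 -> b != 0 ->
  (forall k, (a *: c1 + b *: c2).2 0 k != 0) ->
  has_coords P (cremona_pcoords (a *: c1 + b *: c2)) -> ~ E P.
Proof.
move=> a0 b0 w0 Pc.
have wE c : has_coords P (cremona_pcoords c) ->
    exists k, forall l, a * c1.2 0 l + b * c2.2 0 l = k * c.2 0 l.
  move=> /(has_coordsZ _ Pc) [k k0 e]; exists k => l.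
  apply/esym; rewrite -[c.2 0 l]invrK -cremona_pcoords1 e scale_pcoords1.
  by rewrite cremona_pcoords1 invfM invrK mulVKf // comb_w.
case=> /wE [k h]; have hi := h i; have hj := h j.
  have /eqP : b * D = 0.
    have -> : b * D = c1.2 0 i * (a * c1.2 0 j + b * c2.2 0 j) -
      c1.2 0 j * (a * c1.2 0 i + b * c2.2 0 i) by rewrite /D; ring.
    by rewrite hi hj; ring.
  by rewrite mulf_eq0 (negPf b0) (negPf D0).
have /eqP : a * D = 0.
  have -> : a * D = c2.2 0 j * (a * c1.2 0 i + b * c2.2 0 i) -
    c2.2 0 i * (a * c1.2 0 j + b * c2.2 0 j) by rewrite /D; ring.
  by rewrite hi hj; ring.
by rewrite mulf_eq0 (negPf a0) (negPf D0).
Qed.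

Definition ascending_arc : set PP :=
  [set P | exists a b : R, [/\ 0 < a, 0 < b &
     has_coords P (cremona_pcoords (a *: c1 + b *: c2))]].
Let K := ascending_arc.

Let comb_gt0 (a b : R) k : 0 <= a -> 0 < b -> 0 < (a *: c1 + b *: c2).2 0 k.
Proof. by move=> a0 b0; rewrite comb_w ltr_wpDl ?mulr_ge0 ?mulr_gt0 // ltW. Qed.

Lemma ascending_arc_sub : K `<=` G `\` E.
Proof.
move=> P [a [b [a0 b0 Pc]]].
have w0 k : (a *: c1 + b *: c2).2 0 k != 0 by rewrite gt_eqF // comb_gt0 // ltW.
split; first by apply: subset_closure; exists a, b.
by apply: not_end w0 Pc; rewrite gt_eqF.
Qed.

Lemma connected_ascending_arc : connected K.
Proof.
have w0 k : (c1 + 0 *: c2).2 0 k != 0 by rewrite scale0r addr0 gt_eqF.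
(* [g] gives a continuous choice of Plücker coordinates along the arc, parametrized by t = b / a >
   0. *)
have [g [gc _ gE _]] := cremona_curve_extension 0 i w0.
have {}gE t : 0 < t -> exists2 k : R, k != 0 &
    g t = k *: cremona_pcoords (c1 + t *: c2).
  move=> t0; apply: gE; first by rewrite gt_eqF.
  by move=> k; rewrite -[c1]scale1r gt_eqF // comb_gt0.
rewrite (_ : K = [set P | exists2 t, `]0, +oo[%classic t & has_coords P (g t)]).
  apply: connected_curve gc _ _ => [|t].
    by apply/connected_intervalP; exact: interval_is_interval.
  rewrite /= in_itv /= andbT => t0; have [k k0 gtE] := gE t t0.
  have wi : (c1 + t *: c2).2 0 i != 0 by rewrite -[c1]scale1r gt_eqF // comb_gt0.
  have [P Pc] := has_coords_pt (cremona_pcoords_nonzero wi).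
  by apply: (@has_coords_nonzero _ _ P); rewrite gtE; exact: has_coordsZ1.
apply/seteqP; split=> P.
  move=> [a [b [a0 b0 Pc]]]; exists (b / a); first by rewrite /= in_itv /= divr_gt0.
  have [|k k0 ->] := gE (b / a); first exact: divr_gt0.
  apply: has_coordsZ1 => //.
  have -> : c1 + (b / a) *: c2 = a^-1 *: (a *: c1 + b *: c2).
    by rewrite scalerDr !scalerA mulVf ?gt_eqF // scale1r mulrC.
  rewrite cremona_pcoordsZ ?invr_eq0 ?gt_eqF // invrK.
  by apply: has_coordsZ1 => //; rewrite gt_eqF.
move=> [t]; rewrite /= in_itv /= andbT => t0; have [k k0 ->] := gE t t0.
move=> /(has_coordsZ1 (k := k^-1)); rewrite invr_eq0 scalerA mulVf // scale1r.
by move=> /(_ k0) Pc; exists 1, t; rewrite scale1r.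
Qed.

(** Rescaling by p_{0i} makes all p_{0k} positive, so P lies on the pencil with a b >= 0. A zero
    coefficient would give an end point, and two negative ones would make w negative. The weak
    inequality lets this serve for openness as well as closedness of the arc. *)
Lemma ascending_arc_of_pos P p : G P -> ~ E P -> has_coords P p ->
  (forall k l, 0 < p.1 0 k * p.1 0 l) -> 0 <= alpha p * beta p -> K P.
Proof.
move=> GP nEP Pp pp ab.
have pi0 : p.1 0 i != 0.
  by apply: contraTneq (pp i i) => ->; rewrite mul0r ltxx.
have Pq := has_coordsZ1 pi0 Pp.
have [|a [b [w0 qE]]] := closure_pencil_pos GP Pq.
  by move=> k; rewrite scale_pcoords1.
have wn k : (a *: c1 + b *: c2).2 0 k != 0 by rewrite gt_eqF.
have {}ab : 0 <= a * b.
  have : 0 <= alpha (p.1 0 i *: p) * beta (p.1 0 i *: p).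
    rewrite /alpha /beta !scale_pcoords1.
    rewrite -[X in 0 <= X](_ : p.1 0 i ^+ 2 * (alpha p * beta p) = _).
      by rewrite mulr_ge0 // sqr_ge0.
    by rewrite /alpha /beta; ring.
  by rewrite qE; have [z z0 ->] := alpha_betaE wn; rewrite pmulr_lge0.
rewrite qE in Pq.
have a0 : a != 0.
  apply/eqP => a0; apply: nEP; right; move: Pq (w0 i); rewrite a0 scale0r add0r.
  move=> Pq bp; have b0 : b != 0.
    by apply: contraTneq bp => ->; rewrite scale0r mxE ltxx.
  have := has_coordsZ1 b0 Pq.
  by rewrite cremona_pcoordsZ // scalerA mulfV // scale1r.
have b0 : b != 0.
  apply/eqP => b0; apply: nEP; left; move: Pq (w0 i); rewrite b0 scale0r addr0.
  move=> Pq bp; have := has_coordsZ1 a0 Pq.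
  by rewrite cremona_pcoordsZ // scalerA mulfV // scale1r.
exists a, b; suff [? ?] : 0 < a /\ 0 < b by [].
have {}ab : 0 < a * b by rewrite lt_neqAle ab eq_sym mulf_neq0.
have [ap|an] := ltP 0 a; first by rewrite -(pmulr_rgt0 b ap).
have {}an : a < 0 by rewrite lt_neqAle a0.
have bn : b < 0 by rewrite -(nmulr_rgt0 b an).
have := w0 i; rewrite comb_w.
by rewrite ltNge ltW // ltr_wnDl ?nmulr_rlt0 // nmulr_rle0 // ltW.
Qed.

Lemma ascending_arc_clopen (A : set PP) P :
  connected A -> A `<=` G `\` E -> A P -> K P -> A `<=` K.
Proof.
move=> cA AG AP KP.
(* [M] bounds w_k / w_l and [Y] bounds |y_k - y_l| / w_k for both lines, hence for all their
   positive combinations. *)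
have [M M0 hM] := finite_ub (fun kl : 'I_d * 'I_d =>
  Num.max (c1.2 0 kl.1 / c1.2 0 kl.2) (c2.2 0 kl.1 / c2.2 0 kl.2)).
have [Y Y0 hY] := finite_ub (fun kl : 'I_d * 'I_d =>
  Num.max (`|c1.1 0 kl.1 - c1.1 0 kl.2| / c1.2 0 kl.1)
          (`|c2.1 0 kl.1 - c2.1 0 kl.2| / c2.2 0 kl.1)).
have ca : continuous alpha by rewrite /alpha; continuous_expr.
have cb : continuous beta by rewrite /beta; continuous_expr.
pose f1 (_ : unit) p := alpha p * beta p.
pose f2 (kl : 'I_d * 'I_d) (p : coords) := p.1 0 kl.1 * p.1 0 kl.2.
(* In Plücker coordinates the bounds read p_{0l}^2 <= M p_{0k} p_{0l} and p_{kl}^2 <= (M Y)^2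
   p_{0m}^2. Being quadratic, they do not depend on the representative. *)
pose f3' k l (p : coords) := M * (p.1 0 k * p.1 0 l) - p.1 0 l * p.1 0 l.
pose f3 (kl : 'I_d * 'I_d) := f3' kl.1 kl.2.
pose f4' k l m (p : coords) :=
  (M * Y) ^+ 2 * (p.1 0 m * p.1 0 m) - p.2 k l * p.2 k l.
pose f4 (klm : 'I_d * 'I_d * 'I_d) := f4' klm.1.1 klm.1.2 klm.2.
have f1c u : continuous (f1 u) by rewrite /f1; continuous_expr.
have f2c u : continuous (f2 u) by rewrite /f2; continuous_expr.
have f3c u : continuous (f3 u) by rewrite /f3 /f3'; continuous_expr.
have f4c u : continuous (f4 u) by rewrite /f4 /f4'; continuous_expr.
have oU := open_coords (openI (open_positive f1c) (open_positive f2c)).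
have cF := closed_coords (closedI (closed_nonnegative f1c)
  (closedI (closed_nonnegative f3c) (closed_nonnegative f4c))).
suff <- : A `&` K = A by move=> ? [].
apply: cA; first by exists P.
- eexists; first exact: oU.
  apply/seteqP; split=> Q [AQ].
    move=> [a [b [a0 b0 Qc]]]; split=> //; eexists; first exact: Qc.
    have w0 k : 0 < (a *: c1 + b *: c2).2 0 k by apply: comb_gt0 => //; exact: ltW.
    have wn k : (a *: c1 + b *: c2).2 0 k != 0 by rewrite gt_eqF.
    split=> [u|[k l]] /=; last by rewrite /f2 !cremona_pcoords1 mulr_gt0 // invr_gt0.
    by rewrite /f1; have [z z0 ->] := alpha_betaE wn; rewrite !mulr_gt0.
  move=> [p Qp [f1p f2p]]; split=> //; have [GQ nEQ] := AG _ AQ.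
  apply: (ascending_arc_of_pos GQ nEQ Qp); last by apply: ltW; exact: (f1p tt).
  by move=> k l; exact: (f2p (k, l)).
- eexists; first exact: cF.
  apply/seteqP; split=> Q [AQ].
    move=> [a [b [a0 b0 Qc]]]; split=> // _ /(has_coordsZ _ Qc) [r r0 ->].
    have w0 k : 0 < (a *: c1 + b *: c2).2 0 k by apply: comb_gt0 => //; exact: ltW.
    have wn k : (a *: c1 + b *: c2).2 0 k != 0 by rewrite gt_eqF.
    have wM k l : (a *: c1 + b *: c2).2 0 k <= M * (a *: c1 + b *: c2).2 0 l.
      have := hM (k, l); rewrite /= ge_max !ler_pdivrMr // => /andP[h1 h2].
      have := ler_wpM2l (ltW a0) h1; have := ler_wpM2l (ltW b0) h2.
      by rewrite !comb_w; lra.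
    have yY k l : `|(a *: c1 + b *: c2).1 0 k - (a *: c1 + b *: c2).1 0 l| <=
        Y * (a *: c1 + b *: c2).2 0 k.
      have := hY (k, l); rewrite /= ge_max !ler_pdivrMr // => /andP[h1 h2].
      have -> : (a *: c1 + b *: c2).1 0 k - (a *: c1 + b *: c2).1 0 l =
        a * (c1.1 0 k - c1.1 0 l) + b * (c2.1 0 k - c2.1 0 l).
        by rewrite !comb_y; ring.
      apply: (le_trans (ler_normD _ _)).
      rewrite !normrM (gtr0_norm a0) (gtr0_norm b0).
      have := ler_wpM2l (ltW a0) h1; have := ler_wpM2l (ltW b0) h2.
      by rewrite !comb_w; lra.
    split=> [u|]; [|split=> [[k l]|[[k l] m]]].
    - rewrite /f1; have [z z0] := alpha_betaE wn; set p := cremona_pcoords _ => zE.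
      have -> : alpha (r *: p) * beta (r *: p) = r ^+ 2 * (alpha p * beta p).
        by rewrite /alpha /beta !scale_pcoords1; ring.
      by apply: mulr_ge0; [exact: sqr_ge0|rewrite zE ltW // !mulr_gt0].
    - set c := a *: c1 + b *: c2 in w0 wn wM yY *.
      rewrite /f3 /= /f3' !scale_pcoords1 !cremona_pcoords1.
      move: (w0 k) (w0 l) (wM k l) (wn k) (wn l).
      move: (c.2 0 k) (c.2 0 l) => x y x0 y0 xy xn yn.
      have -> : M * (r / x * (r / y)) - r / y * (r / y) =
        (r / y) ^+ 2 / x * (M * y - x) by field; rewrite xn yn.
      by rewrite mulr_ge0 ?subr_ge0 // divr_ge0 ?sqr_ge0 // ltW.
    - set c := a *: c1 + b *: c2 in w0 wn wM yY *.
      rewrite /f4 /= /f4' !scale_pcoords1 !scale_pcoords2 !cremona_pcoords1 cremona_pcoords2.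
      move: (w0 k) (w0 l) (w0 m) (wM m l) (yY k l) (wn k) (wn l) (wn m).
      move: (c.2 0 k) (c.2 0 l) (c.2 0 m) (c.1 0 k - c.1 0 l) => x y z v.
      move=> x0 y0 z0 zy vx xn yn zn.
      have -> : (M * Y) ^+ 2 * (r / z * (r / z)) -
          r * (v / (x * y)) * (r * (v / (x * y))) =
        r ^+ 2 * (M * Y / z - v / (x * y)) * (M * Y / z + v / (x * y)).
        by field; rewrite xn yn zn.
      have : `|v / (x * y)| <= M * Y / z.
        rewrite normrM [`|_^-1|]gtr0_norm ?invr_gt0 ?mulr_gt0 //.
        rewrite ler_pdivrMr ?mulr_gt0 //; apply: (le_trans vx).
        rewrite mulrAC ler_pdivlMr //.
        have -> : M * Y * (x * y) = Y * x * (M * y) by ring.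
        by rewrite ler_pM2l // mulr_gt0.
      rewrite ler_norml => /andP[v1 v2].
      by apply: mulr_ge0; [apply: mulr_ge0; [exact: sqr_ge0|]|]; lra.
  move=> h; split=> //; have [GQ nEQ] := AG _ AQ.
  have [p Qp] := has_coords_ex Q; have [f1p [f3p f4p]] := h p Qp.
  (* If one p_{0k} vanished, [f3] would annihilate every p_{0l} and [f4] every p_{lm}, leaving the
     zero vector. *)
  have pn k : p.1 0 k != 0.
    apply/eqP => pk; have [_] := has_coords_nonzero Qp; apply.
    have sq0 (x : R) : 0 <= - (x * x) -> x = 0.
      by rewrite oppr_ge0 -expr2 => x0; apply/eqP; rewrite -sqrf_eq0 eq_le x0 sqr_ge0.
    apply: pair_ext.
      apply/rowP => l; rewrite mxE; apply: sq0.
      by have := f3p (k, l); rewrite /f3 /= /f3' pk mul0r mulr0 sub0r.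
    apply/matrixP => l m; rewrite mxE; apply: sq0.
    by have := f4p (l, m, k); rewrite /f4 /= /f4' pk mul0r mulr0 sub0r.
  apply: (ascending_arc_of_pos GQ nEQ Qp); last exact: (f1p tt).
  move=> k l; have := f3p (k, l); rewrite /f3 /= /f3' subr_ge0 -expr2.
  rewrite -(pmulr_rgt0 _ M0); apply: lt_le_trans.
  by rewrite lt_neqAle sqr_ge0 eq_sym expf_neq0.
Qed.

Lemma connected_component_arc P : K P -> connected_component (G `\` E) P = K.
Proof.
move=> KP; have GEP := ascending_arc_sub KP; apply/seteqP; split.
  apply: (@ascending_arc_clopen _ P) => //.
  - exact: component_connected.
  - exact: connected_component_sub.
  - exact: connected_component_refl.
apply: connected_component_max => //; first exact: ascending_arc_sub.
exact: connected_ascending_arc.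
Qed.

End TwoPoints.

End Span.

(** * The arc with coefficients of opposite signs *)

Section Escape.
Set Implicit Arguments.
Unset Strict Implicit.
Context {R : realType} {d : nat}.
Notation coords := ('rV[R]_d * 'M[R]_d)%type.
Notation PP := (plucker_space R d).
Implicit Types (c : 'rV[R]_d * 'rV[R]_d) (p q : coords) (P : PP).

(* Follow c1 - t c2 from t = lambda up to the first t for which one of the
   coordinates w_k vanishes. *)
Lemma other_arc_escape c1 c2 (i j : 'I_d) (lambda : R) (G E : set PP) P :
  (forall k, 0 < c1.2 0 k) -> (forall k, 0 < c2.2 0 k) ->
  c1.2 0 i * c2.2 0 j - c1.2 0 j * c2.2 0 i != 0 ->
  (forall P, E P -> has_coords P (cremona_pcoords c1) \/
                    has_coords P (cremona_pcoords c2)) ->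
  closed G ->
  (forall t P, (forall k, (c1 + t *: (- c2)).2 0 k != 0) ->
     has_coords P (cremona_pcoords (c1 + t *: (- c2))) -> G P) ->
  0 < lambda -> (forall k, 0 < (c1 + lambda *: (- c2)).2 0 k) ->
  has_coords P (cremona_pcoords (c1 + lambda *: (- c2))) ->
  exists P' p k, [/\ connected_component (G `\` E) P P', has_coords P' p &
    p.1 0 k = 0].
Proof.
move=> c1p c2p D0 hE cG hG l0 wl Pc.
have wE t k : (c1 + t *: (- c2)).2 0 k = c1.2 0 k - t * c2.2 0 k.
  by rewrite !mxE mulrN.
have c2n k : c2.2 0 k != 0 by rewrite gt_eqF.
(* The smallest ratio w1_k / w2_k is the first parameter [t0] at which a coordinate of w1 - t w2
   vanishes. *)
have [i1 _ min1] := @arg_minP _ _ _ i predT (fun k => c1.2 0 k / c2.2 0 k) isT.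
pose t0 := c1.2 0 i1 / c2.2 0 i1.
have w_pos t k : t < t0 -> 0 < (c1 + t *: (- c2)).2 0 k.
  move=> tt0; rewrite wE subr_gt0 -ltr_pdivlMr //.
  by apply: (lt_le_trans tt0); exact: min1.
have lt0 : lambda < t0.
  by rewrite /t0 ltr_pdivlMr // -subr_gt0 -wE.
(* Not all coordinates vanish at [t0], since w1 and w2 are not proportional; at such an index [j1]
   the extended curve has p_{0 j1} = 0. *)
have [j1 wj1] : exists j1, (c1 + t0 *: (- c2)).2 0 j1 != 0.
  apply: contrapT => np; move: D0; apply/negP; rewrite negbK.
  have wk k : c1.2 0 k = t0 * c2.2 0 k.
    apply/eqP; rewrite -subr_eq0 -wE; apply: contraT => wk.
    by exfalso; apply: np; exists k.
  by rewrite !wk; apply/eqP; ring.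
have wi1 : (c1 + t0 *: (- c2)).2 0 i1 = 0 by rewrite wE /t0 divfK // subrr.
have wn : forall k, (c1 + lambda *: (- c2)).2 0 k != 0.
  by move=> k; rewrite gt_eqF.
have [g [gc g0 gE gv]] := cremona_curve_extension t0 i wn.
have gj1 := gv _ _ wi1 wj1.
have {}gE t : t < t0 -> exists2 r : R, r != 0 &
    g t = r *: cremona_pcoords (c1 + t *: (- c2)).
  by move=> tt0; apply: gE; [rewrite lt_eqF|move=> k; rewrite gt_eqF // w_pos].
have gP t Q : t < t0 -> has_coords Q (g t) ->
    has_coords Q (cremona_pcoords (c1 + t *: (- c2))).
  move=> tt0; have [r r0 ->] := gE t tt0.
  move=> /(has_coordsZ1 (k := r^-1)); rewrite invr_eq0 scalerA mulVf // scale1r.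
  exact.
have gn t : t < t0 -> nonzero_pcoords (g t).
  move=> tt0; have [r r0 gtE] := gE t tt0.
  have wi : (c1 + t *: (- c2)).2 0 i != 0 by rewrite gt_eqF // w_pos.
  have [Q Qc] := has_coords_pt (cremona_pcoords_nonzero wi).
  by apply: (@has_coords_nonzero _ _ Q); rewrite gtE; exact: has_coordsZ1.
have gnJ t : `[lambda, t0]%classic t -> nonzero_pcoords (g t).
  rewrite /= in_itv /= => /andP[_]; rewrite le_eqVlt => /orP[/eqP ->//|].
  exact: gn.
pose S : set PP := [set Q | exists2 t, `[lambda, t0]%classic t & has_coords Q (g t)].
have cS : connected S.
  apply: connected_curve gc _ gnJ.
  by apply/connected_intervalP; exact: interval_is_interval.
have SP : S P.
  exists lambda; first by rewrite /= in_itv /= lexx ltW.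
  by have [r r0 ->] := gE _ lt0; exact: has_coordsZ1.
have gG t Q : t < t0 -> has_coords Q (g t) -> G Q.
  by move=> tt0 /(gP _ _ tt0); apply: hG => k; rewrite gt_eqF // w_pos.
have SG : S `<=` G `\` E.
  move=> Q [t]; rewrite /= in_itv /= => /andP[lt].
  rewrite le_eqVlt => /orP[/eqP ->|tt0] Qt.
    split.
      (* The limit point lies in the closed set [G], being approached from parameters below [t0]. It
         is not an end point because its p_{0 j1} vanishes. *)
      apply: (closed_curve_limit (J := `]-oo, t0[%classic) (gc t0) _ _ cG _ Qt).
      - move=> A /nbhs_ballP [e /= e0 eA]; exists (t0 - e / 2); split.
          by rewrite /= in_itv /= gtrBl divr_gt0.
        apply: eA; rewrite /ball /= opprB addrC subrK gtr0_norm ?divr_gt0 //.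
        by rewrite ltr_pdivrMr // ltr_pMr // ltr1n.
      - by move=> t'; rewrite /= in_itv; exact: gn.
      - by move=> t' Q'; rewrite /= in_itv; exact: gG.
    move=> /hE H; suff [c cp /(has_coordsZ _ Qt) [r r0 e]] : exists2 c : 'rV[R]_d * 'rV[R]_d,
        (forall k, 0 < c.2 0 k) & has_coords Q (cremona_pcoords c).
      have := cremona_pcoords1 c j1; rewrite e scale_pcoords1 gj1 mulr0.
      by move/eqP; rewrite eq_sym invr_eq0 gt_eqF.
    by case: H => ?; [exists c1|exists c2].
  split; first exact: gG Qt.
  have tn : - t != 0 by rewrite oppr_eq0 gt_eqF // (lt_le_trans l0).
  have cE : c1 + t *: - c2 = 1 *: c1 + (- t) *: c2.
    by rewrite scale1r scalerN scaleNr.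
  have := gP _ _ tt0 Qt; rewrite cE => /(not_end D0 (oner_neq0 _) tn) H /hE.
  by apply: H => k; rewrite -cE gt_eqF // w_pos.
have [P' P'c] := has_coords_pt g0.
exists P', (g t0), j1; split=> //.
apply: (@connected_component_max _ _ S) => //.
by exists t0 => //; rewrite /= in_itv /= lexx ltW.
Qed.

End Escape.

(** * The interval of ascending lines *)

Section Interval.
Set Implicit Arguments.
Unset Strict Implicit.
Context {R : realType} {d : nat}.
Variables (l1 l2 : set 'rV[R]_d) (c1 c2 : 'rV[R]_d * 'rV[R]_d).
Hypotheses (lc1 : cremona_coords l1 c1) (lc2 : cremona_coords l2 c2).
Notation PP := (plucker_space R d).

Let c1p : forall k, 0 < c1.2 0 k.
Proof. by case: ((cremona_coordsP _ _).1 lc1). Qed.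
Let c2p : forall k, 0 < c2.2 0 k.
Proof. by case: ((cremona_coordsP _ _).1 lc2). Qed.

Lemma plucker_image_pair : plucker_image [set l1; l2] =
  [set P : PP | has_coords P (cremona_pcoords c1) \/ has_coords P (cremona_pcoords c2)].
Proof.
apply/seteqP; split=> P.
  by move=> [l [->|->]]; [move=> /(plucker_point_line_of _ lc1)|
    move=> /(plucker_point_line_of _ lc2)]; [left|right].
case=> Pc; [exists l1; first by left|exists l2; first by right].
  exact/(plucker_point_line_of _ lc1).
exact/(plucker_point_line_of _ lc2).
Qed.

Lemma plucker_image_cremona_hull :
  plucker_image (cremona_hull [set l1; l2]) =
  ascending_arc c1 c2 `|` plucker_image [set l1; l2].
Proof.
rewrite plucker_image_pair; apply/seteqP; split=> P.
  move=> [l /(cremona_hull2 lc1 lc2) [s [t [s0 t0 st lc]]]].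
  move=> /(plucker_point_line_of _ lc) Pc.
  move: s0; rewrite le_eqVlt => /orP[/eqP s0|s0].
    right; right; move: Pc st; rewrite -s0 scale0r !add0r => + t1.
    by rewrite t1 scale1r.
  move: t0; rewrite le_eqVlt => /orP[/eqP t0|t0]; last by left; exists s, t.
  right; left; move: Pc st; rewrite -t0 scale0r !addr0 => + s1.
  by rewrite s1 scale1r.
suff H s t : 0 <= s -> 0 <= t -> s + t = 1 ->
    has_coords P (cremona_pcoords (s *: c1 + t *: c2)) ->
    plucker_image (cremona_hull [set l1; l2]) P.
  case=> [[a [b [a0 b0 Pc]]]|[Pc|Pc]].
  - have ab : 0 < a + b by rewrite addr_gt0.
    apply: (H (a / (a + b)) (b / (a + b))); rewrite ?divr_ge0 ?ltW //.
      by rewrite -mulrDl mulfV // gt_eqF.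
    have -> : (a / (a + b)) *: c1 + (b / (a + b)) *: c2 =
        (a + b)^-1 *: (a *: c1 + b *: c2).
      by rewrite scalerDr !scalerA ![(a + b)^-1 * _]mulrC.
    rewrite cremona_pcoordsZ ?invr_eq0 ?gt_eqF // invrK.
    by apply: has_coordsZ1 => //; rewrite gt_eqF.
  - by apply: (H 1 0); rewrite ?addr0 // scale1r scale0r addr0.
  - by apply: (H 0 1); rewrite ?add0r // scale1r scale0r add0r.
move=> s0 t0 st Pc; set c := s *: c1 + t *: c2 in Pc *.
have lc : cremona_coords (line_of c) c.
  have [_ _ sy1 sw1] := (cremona_coordsP _ _).1 lc1.
  have [_ _ sy2 sw2] := (cremona_coordsP _ _).1 lc2.
  apply/cremona_coordsP; split=> //.
  - move=> k; rewrite comb_w.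
    have [s00|s1] := eqVneq s 0.
      have t1 : t = 1 by rewrite -st s00 add0r.
      by rewrite s00 t1 mul0r add0r mul1r.
    apply: ltr_pwDl; last by rewrite mulr_ge0 // ltW.
    by rewrite mulr_gt0 // lt_neqAle eq_sym s1.
  - under eq_bigr do rewrite comb_y.
    by rewrite big_split /= -!mulr_sumr sy1 sy2 !mulr0 addr0.
  - under eq_bigr do rewrite comb_w.
    by rewrite big_split /= -!mulr_sumr sw1 sw2 !mulr1.
exists (line_of c); last exact/(plucker_point_line_of _ lc).
by apply/(cremona_hull2 lc1 lc2); exists s, t.
Qed.

(** A point of the chosen component is an ascending line, so it comes from some a c1 + b c2 with
    positive w. Coefficients of opposite signs let the component escape from the ascending lines, a
    zero coefficient gives an end point, and two positive ones identify the component with the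
    arc. *)
Lemma ascending_intervalP (dd : different_directions l1 l2) (I : set PP) :
  ascending_interval l1 l2 I <-> I = plucker_image (cremona_hull [set l1; l2]).
Proof.
have [i [j D0]] := different_directions_coords lc1 lc2 dd.
rewrite /ascending_interval /interval_on plucker_image_cremona_hull.
rewrite (cremona_spanE lc1 lc2).
have KE := connected_component_arc c1p c2p D0.
have KG := @ascending_arc_sub _ _ _ _ _ _ c1p c2p D0.
rewrite -plucker_image_pair in KE KG.
split=> [[[P GP ->] asc]|->]; last first.
  split.
    have w0 : (1 *: c1 + 1 *: c2).2 0 i != 0.
      by rewrite comb_w !mul1r gt_eqF // addr_gt0.
    have [P Pc] := has_coords_pt (cremona_pcoords_nonzero w0).
    have KP : ascending_arc c1 c2 P by exists 1, 1.
    by exists P; [exact: KG|rewrite KE].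
  rewrite -plucker_image_cremona_hull => P [l]; move=> /cremona_hull_sub_frame_hull.
  by move=> /(_ _ _ lc1 lc2) [al _] lP; exists l.
have [c Pc cp] : exists2 c, has_coords P (cremona_pcoords c) & forall k, 0 < c.2 0 k.
  apply: plucker_image_ascending; apply: asc; left.
  exact: connected_component_refl.
(* Ascending lines have no vanishing p_{0k}, so an ascending interval contains no such point. *)
have escape : ~ exists P' p k, [/\ connected_component
    (closure (pencil_image c1 c2) `\` plucker_image [set l1; l2]) P P',
    has_coords P' p & p.1 0 k = 0].
  move=> [P' [p [k [CP' P'p pk]]]].
  have [c' /(has_coordsZ _ P'p) [r r0 e] c'p] : exists2 c',
    has_coords P' (cremona_pcoords c') & forall k, 0 < c'.2 0 k.
    by apply: plucker_image_ascending; apply: asc; left.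
  have := cremona_pcoords1 c' k; rewrite e scale_pcoords1 pk mulr0 => /eqP.
  by rewrite eq_sym invr_eq0 gt_eqF.
have [GP1 GP2] := GP.
have [|a [b [w0 cE]]] := closure_pencil_pos D0 GP1 Pc.
  by move=> k; rewrite cremona_pcoords1 invr_gt0.
rewrite {}cE in Pc; congr (_ `|` _).
have cG : closed (closure (pencil_image c1 c2)) by exact: closed_closure.
have [a0|a0|a0] := ltgtP a 0.
- have b0 : 0 < b.
    rewrite ltNge; apply/negP => b0; have := w0 i; rewrite comb_w ltNge.
    by rewrite -oppr_ge0 opprD addr_ge0 // -mulNr mulr_ge0 ?oppr_ge0 // ltW.
  exfalso; apply: escape.
  (* Here a < 0 < b, so the escape starts at [c2] and moves along c2 - t c1 from t = -a / b. *)
  have cE : a *: c1 + b *: c2 = b *: (c2 + (- a / b) *: (- c1)).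
    rewrite scalerDr scalerA mulrCA mulfV ?gt_eqF // mulr1 scalerN scaleNr opprK.
    by rewrite addrC.
  have D'0 : c2.2 0 i * c1.2 0 j - c2.2 0 j * c1.2 0 i != 0.
    by rewrite -oppr_eq0 opprB mulrC [c2.2 _ _ * _]mulrC.
  apply: (other_arc_escape c2p c1p D'0 _ cG _ (lambda := - a / b)).
  + by rewrite plucker_image_pair => Q [?|?]; [right|left].
  + move=> t Q wt Qc; apply: subset_closure; exists (- t), 1.
    by rewrite scale1r addrC scaleNr -scalerN.
  + by rewrite divr_gt0 ?oppr_gt0.
  + move=> k; have := w0 k; rewrite cE [X in 0 < X -> _]mxE pmulr_rgt0 //.
  + move: Pc; rewrite cE cremona_pcoordsZ ?gt_eqF // => /(has_coordsZ1 (k := b)).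
    by rewrite scalerA mulfV ?gt_eqF // scale1r; exact.
- have [b0|b0|b0] := ltgtP b 0.
  + exfalso; apply: escape.
    have cE : a *: c1 + b *: c2 = a *: (c1 + (- b / a) *: (- c2)).
      by rewrite scalerDr scalerA mulrCA mulfV ?gt_eqF // mulr1 scalerN scaleNr opprK.
    apply: (other_arc_escape c1p c2p D0 _ cG _ (lambda := - b / a)).
    * by rewrite plucker_image_pair.
    * move=> t Q wt Qc; apply: subset_closure; exists 1, (- t).
      by rewrite scale1r scaleNr -scalerN.
    * by rewrite divr_gt0 ?oppr_gt0.
    * by move=> k; have := w0 k; rewrite cE [X in 0 < X -> _]mxE pmulr_rgt0.
    * move: Pc; rewrite cE cremona_pcoordsZ ?gt_eqF // => /(has_coordsZ1 (k := a)).
      by rewrite scalerA mulfV ?gt_eqF // scale1r; exact.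
  + by rewrite KE //; exists a, b.
  + exfalso; apply: GP2; rewrite plucker_image_pair; left; move: Pc.
    rewrite b0 scale0r addr0 cremona_pcoordsZ ?gt_eqF //.
    move=> /(has_coordsZ1 (k := a)); rewrite scalerA mulfV ?gt_eqF // scale1r.
    exact.
- exfalso; apply: GP2; rewrite plucker_image_pair; right; move: Pc (w0 i).
  rewrite a0 scale0r add0r => Pc bi.
  have b0 : b != 0 by apply: contraTneq bi => ->; rewrite scale0r mxE ltxx.
  move: Pc; rewrite cremona_pcoordsZ //.
  by move=> /(has_coordsZ1 b0); rewrite scalerA mulfV // scale1r.
Qed.

End Interval.

Theorem corollary18 (R : realType) (d : nat) (l1 l2 : set 'rV[R]_d)
    (asc1 : ascending l1) (asc2 : ascending l2)
    (diff : different_directions l1 l2) :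
  (forall I : set (plucker_space R d),
     ascending_interval l1 l2 I <->
     I = plucker_image (cremona_hull [set l1; l2])) /\
  (d = 2%N \/
   (l1 `&` l2 = set0 /\
    forall v1 v2, is_direction l1 v1 -> is_direction l2 v2 ->
      span_avoids_codim2 v1 v2) ->
   frame_hull l1 l2 = cremona_hull [set l1; l2]).
Proof.
have [c1 lc1] := ascending_coords asc1; have [c2 lc2] := ascending_coords asc2.
split; first by move=> I; exact: ascending_intervalP lc1 lc2 diff I.
exact: frame_hull_eq lc1 lc2 diff.
Qed.
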